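(* Let $\varphi(x)$ be an open (quantifier-free) $L_n^2$-formula with parameters from $F_{\mathrm{nb}}$ and $G_{\mathrm{nb}}$. Then for every $m\in\mathcal M_n$ the open comprehension principle $$(\exists X)(\forall y<m)(X(y)\equiv\varphi(y))$$ and the open induction principle $$\neg\varphi(0)\vee\varphi(m)\vee(\exists x<m)(\varphi(x)\wedge\neg\varphi(x+1))$$ are both valid (i.e. have truth value $\mathbf 1$) in $K(M_{n,\lfloor n/2\rfloor},F_{\mathrm{nb}},G_{\mathrm{nb}})$, where $m$ is interpreted as the constant function in $F_{\mathrm{nb}}$ always outputting $m$.
   Context: Setup. $L_{all}$ is the first-order language with a name for every relation and function on $\mathbb N$. Fix an $\aleph_1$-saturated nonstandard model $\mathcal M$ of the true theory $\mathrm{Th}_{L_{all}}(\mathbb N)$, with $\mathbb N\subseteq\mathcal M$ as an initial segment, and a nonstandard number $n\in\mathcal M\setminus\mathbb N$ which is a power of two. Finite sets, functions, sequences and trees are coded by numbers; for a coded set $S$, $|S|\in\mathcal M$ is its cardinality. Any sequence of standard finite objects has a value at index $n$ in $\mathcal M$ (via the corresponding function symbol of $L_{all}$). $\mathrm{st}$ is the standard part of finite $\mathcal M$-rationals; an $\mathcal M$-rational $q$ is infinitesimal if $|q|<1/k$ for all standard $k\ge1$. $\mathcal M_n\subseteq\mathcal M$ is the set of numbers bounded above by $2^{n^{1/t}}$ for some $t\in\mathcal M\setminus\mathbb N$. $L_n\subseteq L_{all}$ consists of all relation symbols and all function symbols whose values on tuples from $\mathcal M_n$ lie in $\mathcal M_n$;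 $\mathcal M_n$ is regarded as an $L_n$-structure. The language $L_n^2$ extends $L_n$ (number sort) by set-sort variables $X,Y,\dots$ standing for functions of finite arity on the number sort, which can be applied to number terms to form number terms, and by equality for the set sort. An expression $X(\overline x)$ used as a formula abbreviates $X(\overline x)\ne0$. $\langle i,j\rangle$ is a pairing function on $\mathcal M_n$. Sample space. $M_{k,\lfloor k/2\rfloor}$ is the set of all $\{E\}$-structures on $\{0,\dots,k-1\}$ in which $E$ is the graph of a function from $\{0,\dots,k-1\}$ to $\{0,\dots,\lfloor k/2\rfloor-1\}$; $M_{n,\lfloor n/2\rfloor}$ is its value at index $n$. For $\omega\in M_{n,\lfloor n/2\rfloor}$ the neighbor of $i<n$ in $\omega$ is the image of $i$ under the function whose graph is $\omega$. Boolean algebra. $\mathcal A$ is the algebra of subsets of $M_{n,\lfloor n/2\rfloor}$ coded in $\mathcal M$, $\mathcal I$ the ideal of those $A$ with $|A|/|M_{n,\lfloor n/2\rfloor}|$ infinitesimal, and $\mathcal B=\mathcal A/\mathcal I$, a complete Boolean algebra with least element $\mathbf 0$, greatest element $\mathbf 1$ and measure $\mu(A/\mathcal I)=\mathrm{st}(|A|/|M_{n,\lfloor n/2\rfloor}|)$. Trees. $\mathcal T_{\mathrm{nb}}$ is the set of all labeled rooted trees coded in $\mathcal M$ such that: each non-leaf node is labeled by some $v\in\{0,\dots,n-1\}$ and has for each $u\in\{0,\dots,n-1\}$ an outgoing edge labeled $u$; each leaf is labeled by an element of $\mathcal M_n$; the depth is at most $n^{1/t}$ (rounded) for some $t\in\mathcal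 M\setminus\mathbb N$. The computation of $T$ on $\omega$ starts at the root and at a node labeled $v$ follows the edge labeled by the neighbor of $v$ in $\omega$ until a leaf is reached; its label is $T(\omega)$. $F_{\mathrm{nb}}$ is the set of all functions on $M_{n,\lfloor n/2\rfloor}$ computed by trees in $\mathcal T_{\mathrm{nb}}$. Random functions. A $k$-ary random function $\Theta$ assigns to each $\omega$ a $k$-ary function $\Theta_\omega$ coded in $\mathcal M$ with arguments from a domain of $k$-tuples from $\mathcal M_n$ and values in $\mathcal M_n$; for $\alpha_0,\dots,\alpha_{k-1}\in F_{\mathrm{nb}}$, $\Theta(\alpha_0,\dots,\alpha_{k-1})$ is the function $\omega\mapsto\Theta_\omega(\alpha_0(\omega),\dots,\alpha_{k-1}(\omega))$, with value $0$ when the arguments are outside the domain. $G_{\mathrm{nb}}$ is the family of all random functions on $M_{n,\lfloor n/2\rfloor}$ such that: for each unary $\Theta\in G_{\mathrm{nb}}$ there is a tuple $(\gamma_0,\dots,\gamma_{r-1})$, $r\in\mathcal M_n$, coded by an element of $\mathcal M$, with all $\gamma_i\in F_{\mathrm{nb}}$ and, for all $\alpha\in F_{\mathrm{nb}}$, $\Theta(\alpha)(\omega)=\gamma_{\alpha(\omega)}(\omega)$ if $\alpha(\omega)<r$ and $0$ otherwise; for each $k$-ary $\Theta\in G_{\mathrm{nb}}$, $k>1$, there is a $(k-1)$-ary $\Theta'\in G_{\mathrm{nb}}$ with $\Theta(\alpha_0,\dots,\alpha_{k-1})=\Theta'(\alpha_0,\dots,\alpha_{k-3},\langle\alpha_{k-2},\alpha_{k-1}\rangle)$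 for all $\alpha_i\in F_{\mathrm{nb}}$. The structure $K=K(M_{n,\lfloor n/2\rfloor},F_{\mathrm{nb}},G_{\mathrm{nb}})$ is the $\mathcal B$-valued $L_n^2$-structure with number sort $F_{\mathrm{nb}}$ and set sort $G_{\mathrm{nb}}$ (function symbols of $L_n$ act pointwise in $\omega$, a $k$-ary $\Theta\in G_{\mathrm{nb}}$ sends $\alpha_0,\dots,\alpha_{k-1}\in F_{\mathrm{nb}}$ to the function $\omega\mapsto\Theta_\omega(\alpha_0(\omega),\dots,\alpha_{k-1}(\omega))$, with value $0$ at those $\omega$ where the arguments are outside the domain of $\Theta_\omega$, so terms evaluate to elements of $F_{\mathrm{nb}}$) and truth values: $[\![\alpha=\beta]\!]=\{\omega:\alpha(\omega)=\beta(\omega)\}/\mathcal I$; $[\![R(\alpha_0,\dots,\alpha_{k-1})]\!]=\{\omega:\mathcal M_n\models R(\alpha_0(\omega),\dots,\alpha_{k-1}(\omega))\}/\mathcal I$ for relation symbols $R\in L_n$; $[\![\Theta=\Xi]\!]=\{\omega:\Theta_\omega=\Xi_\omega\}/\mathcal I$; $[\![-]\!]$ commutes with $\neg,\wedge,\vee$; $\forall x,\exists x$ are interpreted by $\bigwedge_{\alpha\in F_{\mathrm{nb}}},\bigvee_{\alpha\in F_{\mathrm{nb}}}$ and $\forall X,\exists X$ by $\bigwedge_{\Theta\in G_{\mathrm{nb}}},\bigvee_{\Theta\in G_{\mathrm{nb}}}$ (over $\Theta$ of the appropriate arity; here $X$ is unary). *)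

(* Defs.v *)
From HB Require Import structures.
From mathcomp Require Import all_boot all_order all_algebra finmap.
From mathcomp Require Import generic_quotient zify.
From mathcomp Require Import mathcomp_extra boolp classical_sets cardinality.

Set Implicit Arguments.
Unset Strict Implicit.
Unset Printing Implicit Defensive.

Import Order.TTheory GRing.Theory Num.Theory.

Local Open Scope nat_scope.
Local Open Scope classical_set_scope.

(* The symbols of L_all are the functions and the relations on [nat] of all
   finite arities themselves. *)
Record structure := Structure {
  dom :> Type;
  funI : forall k, (k.-tuple nat -> nat) -> k.-tuple dom -> dom;
  relI : forall k, (k.-tuple nat -> Prop) -> k.-tuple dom -> Prop }.

Definition stdN : structure :=
  @Structure nat (fun k f => f) (fun k R => R).

(* [term k] and [form k]: the free variables are indexed by ['I_k]; in
   [Fall p] the bound variable has index 0 and the others are shifted. *)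
Inductive term (k : nat) : Type :=
| Tvar of 'I_k
| Tfun a of (a.-tuple nat -> nat) & ('I_a -> term k).

Inductive form : nat -> Type :=
| Feq k of term k & term k : form k
| Frel k a of (a.-tuple nat -> Prop) & ('I_a -> term k) : form k
| Fnot k of form k : form k
| Fand k of form k & form k : form k
| Fall k of form k.+1 : form k.

Fixpoint evalt (M : structure) k (v : k.-tuple M) (t : term k) : M :=
  match t with
  | Tvar i => tnth v i
  | Tfun a f ts => funI f [tuple evalt v (ts i) | i < a]
  end.

Fixpoint sat (M : structure) k (p : form k) : k.-tuple M -> Prop :=
  match p with
  | Feq _ t u => fun v => evalt v t = evalt v u
  | Frel _ a R ts => fun v => relI R [tuple evalt v (ts i) | i < a]
  | Fnot _ q => fun v => ~ sat q v
  | Fand _ q r => fun v => sat q v /\ sat r v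
  | Fall _ q => fun v => forall x : M, sat q [tuple of x :: v]
  end.

Definition true_theory_model (M : structure) : Prop :=
  forall p : form 0, @sat stdN 0 p [tuple] -> @sat M 0 p [tuple].

(* A formula in one distinguished variable (index 0) together with the values
   in [M] of its parameters. *)
Definition pform (M : structure) := {k : nat & (form k.+1 * k.-tuple M)%type}.

Definition psat (M : structure) (x : M) (q : pform M) : Prop :=
  sat (tagged q).1 [tuple of x :: (tagged q).2].

Definition aleph1_saturated (M : structure) : Prop :=
  forall (A : set M) (p : set (pform M)),
    countable A ->
    (forall q, p q -> forall i, A (tnth (tagged q).2 i)) ->
    (forall F : set (pform M), finite_set F -> F `<=` p ->
       exists x : M, forall q, F q -> psat x q) ->
    exists x : M, forall q, p q -> psat x q.

Section Interpretation.
Variable M : structure.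

Definition std (k : nat) : M := @funI M 0 (fun=> k) [tuple].
Definition nonstd (x : M) : Prop := forall k, x <> std k.

Definition app1 (f : nat -> nat) (x : M) : M :=
  funI (fun t : 1.-tuple nat => f [tnth t 0]) [tuple x].
Definition app2 (f : nat -> nat -> nat) (x y : M) : M :=
  funI (fun t : 2.-tuple nat => f [tnth t 0] [tnth t 1]) [tuple x; y].
Definition rel1 (R : nat -> Prop) (x : M) : Prop :=
  relI (fun t : 1.-tuple nat => R [tnth t 0]) [tuple x].
Definition rel2 (R : nat -> nat -> Prop) (x y : M) : Prop :=
  relI (fun t : 2.-tuple nat => R [tnth t 0] [tnth t 1]) [tuple x; y].
Definition rel3 (R : nat -> nat -> nat -> Prop) (x y z : M) : Prop :=
  relI (fun t : 3.-tuple nat => R [tnth t 0] [tnth t 1] [tnth t 2])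
    [tuple x; y; z].

End Interpretation.

Definition leN (x y : nat) : Prop := x <= y.
Definition ltN (x y : nat) : Prop := x < y.

Definition cpair (i j : nat) : nat := ((i + j) * (i + j).+1)./2 + j.

Definition set_of_code (s : nat) : {fset nat} := odflt fset0 (choice.unpickle s).
Definition memN (x s : nat) : Prop := x \in set_of_code s.
Definition cardN (s : nat) : nat := #|` set_of_code s|.

Definition seq_of_code (s : nat) : seq nat := odflt [::] (choice.unpickle s).
Definition lenN (s : nat) : nat := size (seq_of_code s).
Definition nthN (s i : nat) : nat := nth 0 (seq_of_code s) i.
Definition ctuple k (t : k.-tuple nat) : nat := choice.pickle (tval t).

Definition unionN (s t : nat) : nat :=
  choice.pickle (set_of_code s `|` set_of_code t)%fset.
Definition diffN (s t : nat) : nat :=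
  choice.pickle (set_of_code s `\` set_of_code t)%fset.

(* |A| / |B| < 1 / k *)
Definition ratio_lt (a b k : nat) : Prop :=
  ((cardN a)%:R / (cardN b)%:R < (k%:R)^-1 :> rat)%R.

(* floor of the real number n ^ (1 / t), for t > 0 *)
Definition root (n t : nat) : nat := \max_(r < n.+1 | r ^ t <= n) r.

Definition boundN (n t : nat) : nat := 2 ^ root n t.

Lemma leq_root n t r : r <= n -> r ^ t <= n -> r <= root n t.
Proof.
rewrite -ltnS => rn rtn.
exact: (@leq_bigmax_cond _ (fun i : 'I_n.+1 => i ^ t <= n) _ (Ordinal rn)).
Qed.

Lemma root_exp n t : 0 < n -> root n t ^ t <= n.
Proof.
move=> n0; rewrite /root; elim/big_ind: _ => // [|x y hx hy].
  by apply: leq_trans n0; case: t => // t; rewrite exp0n.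
by rewrite /maxn; case: ifP.
Qed.

Lemma rootS n s : 1 < s -> 2 ^ s <= n -> (root n s).+1 <= root n s./2.
Proof.
move=> s1 sn; have n0 : 0 < n by apply: leq_trans sn; rewrite expn_gt0.
have r2 : 1 < root n s.
  apply: leq_root (sn); apply: leq_trans sn.
  by apply: (leq_trans s1); apply/ltnW/ltn_expl.
have h : (root n s).+1 ^ s./2 <= n.
  apply: leq_trans (root_exp s n0).
  apply: (@leq_trans ((root n s ^ 2) ^ s./2)).
    rewrite leq_exp2r ?half_gt0//.
    by rewrite -mulnn; nia.
  rewrite -expnM mul2n leq_exp2l//.
  by rewrite -{2}(odd_double_half s) leq_addl.
apply: leq_root => //; apply: leq_trans h.
apply: (@leq_trans ((root n s).+1 ^ 1)); first by rewrite expn1.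
by rewrite leq_exp2l ?half_gt0// ltnS ltnW.
Qed.

Lemma root_le n s t : 0 < s -> s <= t -> 0 < n -> root n t <= root n s.
Proof.
move=> s0 st n0; apply: leq_root.
  rewrite /root; elim/big_ind: _ => // [x y hx hy|i _]; last by rewrite -ltnS.
  by rewrite geq_max hx.
have [->|r0] := posnP (root n t); first by rewrite exp0n.
by apply: leq_trans (root_exp t n0); rewrite leq_pexp2l.
Qed.

(* A structure on {0, ..., k - 1} is coded as the set of pairs which is its
   relation E. *)
Definition graph_code k (f : {ffun 'I_k -> 'I_(k./2)}) : nat :=
  choice.pickle [fset x in [seq cpair i (f i) | i : 'I_k]]%fset.
Definition structures (k : nat) : nat :=
  choice.pickle 
    [fset x in [seq graph_code f | f : {ffun 'I_k -> 'I_(k./2)}]]%fset.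

Definition neighbor (w v : nat) : nat := xget 0 [set j | memN (cpair v j) w].

(* Labeled trees: in [GenTree.Node v ts] the node label is [v] and the edge
   labeled [u] leads to the [u]-th element of [ts]. *)
Notation ltree := (GenTree.tree nat).

Fixpoint wf_tree (n : nat) (T : ltree) : bool :=
  match T with
  | GenTree.Leaf _ => true
  | GenTree.Node v ts => [&& v < n, size ts == n & all (wf_tree n) ts]
  end.

Fixpoint leaves (T : ltree) : seq nat :=
  match T with
  | GenTree.Leaf a => [:: a]
  | GenTree.Node _ ts => flatten (map leaves ts)
  end.

Fixpoint depth (T : ltree) : nat :=
  match T with
  | GenTree.Leaf _ => 0
  | GenTree.Node _ ts => (foldr maxn 0 (map depth ts)).+1
  end.

Fixpoint run (w : nat) (T : ltree) : nat :=
  match T with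
  | GenTree.Leaf a => a
  | GenTree.Node v ts => nth 0 (map (run w) ts) (neighbor w v)
  end.

Definition tree_of_code (c : nat) : ltree :=
  odflt (GenTree.Leaf 0) (choice.unpickle c).
Definition wf_treeN (n c : nat) : Prop := wf_tree n (tree_of_code c).
Definition leafN (a c : nat) : Prop := a \in leaves (tree_of_code c).
Definition depthN (c : nat) : nat := depth (tree_of_code c).
Definition runN (c w : nat) : nat := run w (tree_of_code c).
Definition leaf_code (a : nat) : nat := choice.pickle (GenTree.Leaf a : ltree).

(* [std] identifies the natural numbers with an initial segment of the model;
   [idx] is the number n. *)
Record setting := Setting {
  model :> structure;
  model_true : true_theory_model model;
  model_saturated : aleph1_saturated model;
  idx : model;
  idx_nonstd : nonstd idx;
  idx_pow2 : rel1 (fun k => exists j, k = 2 ^ j) idx }.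

Section Transfer.
Variable M : structure.
Hypothesis HM : true_theory_model M.

Fixpoint closeall k : form k -> form 0 :=
  match k with
  | 0 => fun p => p
  | k'.+1 => fun p => closeall (Fall p)
  end.

Lemma sat_closeall (N : structure) k (p : form k) :
  @sat N 0 (closeall p) [tuple] <-> forall v : k.-tuple N, sat p v.
Proof.
elim: k p => [|k IH] p /=.
  by split=> [h v|]; [rewrite tuple0 | apply].
rewrite IH /=; split=> h.
  by case/tupleP=> x v; apply: h.
by move=> v x; apply: h.
Qed.

Lemma transfer k (p : form k) :
  (forall v : k.-tuple nat, @sat stdN k p v) -> forall v : k.-tuple M, sat p v.
Proof. by move=> h; apply/sat_closeall/HM/sat_closeall. Qed.

Definition T0 k (c : nat) : term k :=
  @Tfun k 0 (fun=> c) (fun i => Tvar (widen_ord (leq0n k) i)).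
Definition T1 k (f : nat -> nat) (t : term k) : term k :=
  @Tfun k 1 (fun s => f [tnth s 0]) (fun=> t).
Definition T2 k (f : nat -> nat -> nat) (t u : term k) : term k :=
  @Tfun k 2 (fun s => f [tnth s 0] [tnth s 1]) (fun i => nth t [:: t; u] i).
Definition R1 k (R : nat -> Prop) (t : term k) : form k :=
  @Frel k 1 (fun s => R [tnth s 0]) (fun=> t).
Definition R2 k (R : nat -> nat -> Prop) (t u : term k) : form k :=
  @Frel k 2 (fun s => R [tnth s 0] [tnth s 1]) (fun i => nth t [:: t; u] i).
Definition R3 k (R : nat -> nat -> nat -> Prop) (t u r : term k) : form k :=
  @Frel k 3 (fun s => R [tnth s 0] [tnth s 1] [tnth s 2])
    (fun i => nth t [:: t; u; r] i).
Definition Fimp k (p q : form k) : form k := Fnot (Fand p (Fnot q)).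

Section Eval.
Variables (N : structure) (k : nat) (v : k.-tuple N).

Lemma evalT0 c : evalt v (T0 k c) = std N c.
Proof. by rewrite /= /std; congr funI; apply: val_inj; rewrite tuple0. Qed.
Lemma evalT1 f t : evalt v (T1 f t) = app1 f (evalt v t).
Proof.
rewrite /= /app1; congr funI; apply: eq_from_tnth => i.
by rewrite tnth_mktuple (ord1 i).
Qed.
Lemma evalT2 f t u : evalt v (T2 f t u) = app2 f (evalt v t) (evalt v u).
Proof.
rewrite /= /app2; congr funI; apply: eq_from_tnth => i; rewrite tnth_mktuple.
by case: i => [[|[|i]]].
Qed.
Lemma satR1 R t : sat (R1 R t) v = rel1 R (evalt v t).
Proof.
rewrite /= /rel1; congr relI; apply: eq_from_tnth => i.
by rewrite tnth_mktuple (ord1 i).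
Qed.
Lemma satR2 R t u : sat (R2 R t u) v = rel2 R (evalt v t) (evalt v u).
Proof.
rewrite /= /rel2; congr relI; apply: eq_from_tnth => i; rewrite tnth_mktuple.
by case: i => [[|[|i]]].
Qed.
Lemma satR3 R t u r :
  sat (R3 R t u r) v = rel3 R (evalt v t) (evalt v u) (evalt v r).
Proof.
rewrite /= /rel3; congr relI; apply: eq_from_tnth => i; rewrite tnth_mktuple.
by case: i => [[|[|[|i]]]].
Qed.
Lemma satimp p q : sat (Fimp p q) v = (sat p v -> sat q v).
Proof.
rewrite /=; apply/propext; split=> [h sp|h [sp]]; last by apply; apply: h.
by apply: contrapT => nq; apply: h.
Qed.
Lemma satnot p : sat (Fnot p) v = ~ sat p v. Proof. by []. Qed.
Lemma satand p q : sat (Fand p q) v = (sat p v /\ sat q v). Proof. by []. Qed.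
Lemma sateq t u : sat (Feq t u) v = (evalt v t = evalt v u). Proof. by []. Qed.
Lemma evalV i : evalt v (Tvar i) = tnth v i. Proof. by []. Qed.
End Eval.

Local Notation V n i := (Tvar (@Ordinal n i isT)).

Let satE := (satimp, satnot, satand, sateq, satR1, satR2, satR3,
  evalT0, evalT1, evalT2, evalV).

Lemma transfer1 p : (forall x : nat, @sat stdN 1 p [tuple x]) ->
  forall x : M, sat p [tuple x].
Proof.
move=> h x; apply: transfer => v; case/tupleP: v => a v.
by rewrite (tuple0 v); have := h a; congr (sat p); apply: val_inj.
Qed.

Lemma transfer2 p : (forall x y : nat, @sat stdN 2 p [tuple x; y]) ->
  forall x y : M, sat p [tuple x; y].
Proof.
move=> h x y; apply: transfer => v; case/tupleP: v => a v.
case/tupleP: v => b v; rewrite (tuple0 v).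
by have := h a b; congr (sat p); apply: val_inj.
Qed.

Lemma transfer3 p : (forall x y z : nat, @sat stdN 3 p [tuple x; y; z]) ->
  forall x y z : M, sat p [tuple x; y; z].
Proof.
move=> h x y z; apply: transfer => v; case/tupleP: v => a v.
case/tupleP: v => b v; case/tupleP: v => c v; rewrite (tuple0 v).
by have := h a b c; congr (sat p); apply: val_inj.
Qed.

Lemma transfer4 p : (forall x y z t : nat, @sat stdN 4 p [tuple x; y; z; t]) ->
  forall x y z t : M, sat p [tuple x; y; z; t].
Proof.
move=> h x y z t; apply: transfer => v; case/tupleP: v => a v.
case/tupleP: v => b v; case/tupleP: v => c v; case/tupleP: v => d v.
rewrite (tuple0 v).
by have := h a b c d; congr (sat p); apply: val_inj.
Qed.

Lemma transfer5 p :
  (forall x y z t u : nat, @sat stdN 5 p [tuple x; y; z; t; u]) ->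
  forall x y z t u : M, sat p [tuple x; y; z; t; u].
Proof.
move=> h x y z t u; apply: transfer => v; case/tupleP: v => a v.
case/tupleP: v => b v; case/tupleP: v => c v; case/tupleP: v => d v.
case/tupleP: v => e v; rewrite (tuple0 v).
by have := h a b c d e; congr (sat p); apply: val_inj.
Qed.

Let satN :
  (forall R x, @rel1 stdN R x = R x) *
  (forall R x y, @rel2 stdN R x y = R x y) *
  (forall R x y z, @rel3 stdN R x y z = R x y z) *
  (forall f x, @app1 stdN f x = f x) *
  (forall f x y, @app2 stdN f x y = f x y) *
  (forall k, std stdN k = k).
Proof. by []. Qed.

Lemma set_of_codeK X : set_of_code (choice.pickle X) = X.
Proof. by rewrite /set_of_code choice.pickleK. Qed.

Implicit Types x y z s t u c n m : M.

Lemma mem_union x s t :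
  rel2 memN x (app2 unionN s t) <-> rel2 memN x s \/ rel2 memN x t.
Proof.
have h : forall x s t : M, sat (Fand
  (Fimp (R2 memN (V 3 0) (T2 unionN (V 3 1) (V 3 2)))
        (Fimp (Fnot (R2 memN (V 3 0) (V 3 1))) (R2 memN (V 3 0) (V 3 2))))
  (Fand (Fimp (R2 memN (V 3 0) (V 3 1)) (R2 memN (V 3 0) (T2 unionN (V 3 1) (V 3 2))))
        (Fimp (R2 memN (V 3 0) (V 3 2)) (R2 memN (V 3 0) (T2 unionN (V 3 1) (V 3 2))))))
    [tuple x; s; t].
  apply: transfer3 => a b c; rewrite !satE !satN /tnth /=.
  rewrite /memN /unionN set_of_codeK in_fsetU.
  by split=> [/orP[->|->//]|]; last split=> ->; rewrite ?orbT.
move: (h x s t); rewrite !satE /tnth /= => -[h1 [h2 h3]].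
split=> [/h1 h4|[/h2|/h3] //].
by have [|/h4] := pselect (rel2 memN x s); [left|right].
Qed.

Lemma mem_diff x s t :
  rel2 memN x (app2 diffN s t) <-> rel2 memN x s /\ ~ rel2 memN x t.
Proof.
have h : forall x s t : M, sat (Fand
  (Fimp (R2 memN (V 3 0) (T2 diffN (V 3 1) (V 3 2)))
        (Fand (R2 memN (V 3 0) (V 3 1)) (Fnot (R2 memN (V 3 0) (V 3 2)))))
  (Fimp (R2 memN (V 3 0) (V 3 1)) (Fimp (Fnot (R2 memN (V 3 0) (V 3 2)))
        (R2 memN (V 3 0) (T2 diffN (V 3 1) (V 3 2))))))
    [tuple x; s; t].
  apply: transfer3 => a b c; rewrite !satE !satN /tnth /=.
  rewrite /memN /diffN set_of_codeK in_fsetD.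
  by split=> [/andP[/negP]|-> /negP ->].
move: (h x s t); rewrite !satE /tnth /= => -[h1 h2].
by split=> [/h1|[]].
Qed.

Lemma mem_sub_ratio s t c k :
  (forall x, rel2 memN x s -> rel2 memN x t) ->
  rel3 ratio_lt t c k -> rel3 ratio_lt s c k.
Proof.
pose w (a b : nat) := xget 0 [set x | memN x a /\ ~ memN x b].
have h : forall s t c k : M, sat (Fimp
  (Fimp (R2 memN (T2 w (V 4 0) (V 4 1)) (V 4 0))
        (R2 memN (T2 w (V 4 0) (V 4 1)) (V 4 1)))
  (Fimp (R3 ratio_lt (V 4 1) (V 4 2) (V 4 3))
        (R3 ratio_lt (V 4 0) (V 4 2) (V 4 3)))) [tuple s; t; c; k].
  apply: transfer4 => a b d e; rewrite !satE !satN /tnth /= => sub.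
  have {}sub (x : nat) : memN x a -> memN x b.
    move=> xa; apply: contrapT => xb; move: sub; rewrite /w.
    by case: xgetP => [y _ [ya yb] /(_ ya)|/(_ x) []].
  apply: le_lt_trans; rewrite ler_wpM2r ?invr_ge0 ?ler0n// ler_nat.
  by apply/fsubset_leq_card/fsubsetP.
by move: (h s t c k); rewrite !satE /tnth /= => h1 h2; apply/h1/h2.
Qed.

Lemma ratio_union s t c k :
  rel3 ratio_lt s c (app1 double k) -> rel3 ratio_lt t c (app1 double k) ->
  rel3 ratio_lt (app2 unionN s t) c k.
Proof.
have h : forall s t c k : M, sat (Fimp
  (R3 ratio_lt (V 4 0) (V 4 2) (T1 double (V 4 3)))
  (Fimp (R3 ratio_lt (V 4 1) (V 4 2) (T1 double (V 4 3)))
    (R3 ratio_lt (T2 unionN (V 4 0) (V 4 1)) (V 4 2) (V 4 3))))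
  [tuple s; t; c; k].
  apply: transfer4 => a b d e; rewrite !satE !satN /tnth /= => ha hb.
  have hab := ltrD ha hb; rewrite /ratio_lt.
  have -> : (e%:R^-1 = (e.*2)%:R^-1 + (e.*2)%:R^-1 :> rat)%R.
    by rewrite -mul2n natrM invfM mulrC -splitr.
  apply: le_lt_trans hab; rewrite -mulrDl ler_wpM2r ?invr_ge0 ?ler0n//.
  rewrite -natrD ler_nat /cardN /unionN set_of_codeK cardfsU.
  exact: leq_subr.
by move: (h s t c k); rewrite !satE /tnth.
Qed.

Lemma ratio_empty s c k : 0 < k ->
  (forall x, ~ rel2 memN x s) -> rel3 ratio_lt s c (std M k).
Proof.
move=> k0; pose w (a : nat) := xget 0 [set x | memN x a].
have h : forall s c : M, sat (Fimp
  (Fnot (R2 memN (T1 w (V 2 0)) (V 2 0)))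
  (R3 ratio_lt (V 2 0) (V 2 1) (T0 2 k))) [tuple s; c].
  apply: transfer2 => a b; rewrite !satE !satN /tnth /= => na.
  rewrite /ratio_lt (_ : cardN a = 0) ?mul0r ?invr_gt0 ?ltr0n//.
  apply/eqP; rewrite cardfs_eq0; apply/eqP/fsetP => x; rewrite in_fset0.
  apply/negP => xa; move: na; rewrite /w.
  by case: xgetP => [y _ ya /(_ ya)|/(_ x)].
by move: (h s c); rewrite !satE /tnth /= => h1 h2; apply/h1/h2.
Qed.

Lemma app1_std f k : app1 f (std M k) = std M (f k).
Proof.
have /HM : @sat stdN 0 (Feq (T1 f (T0 0 k)) (T0 0 (f k))) [tuple].
  by rewrite !satE !satN.
by rewrite !satE.
Qed.

Lemma le_std x k : rel2 leN x (std M k) -> exists j, x = std M j.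
Proof.
elim: k => [|k IH] xk.
  exists 0; have h : forall x, sat (Fimp (R2 leN (V 1 0) (T0 1 0))
      (Feq (V 1 0) (T0 1 0))) [tuple x].
    apply: transfer1 => a; rewrite !satE !satN /tnth /= /leN.
    by rewrite leqn0 => /eqP.
  by move: (h x); rewrite !satE /tnth /=; apply.
have [/IH//|nxk] := pselect (rel2 leN x (std M k)).
exists k.+1; have h : forall x, sat (Fimp (R2 leN (V 1 0) (T0 1 k.+1))
   (Fimp (Fnot (R2 leN (V 1 0) (T0 1 k))) (Feq (V 1 0) (T0 1 k.+1)))) [tuple x].
  apply: transfer1 => a; rewrite !satE !satN /tnth /= /leN => h1 /negP.
  by rewrite -ltnNge => h2; apply/eqP; rewrite eqn_leq h1.
by move: (h x); rewrite !satE /tnth /=; apply.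
Qed.

Lemma nonstd_ge x k : nonstd x -> rel2 leN (std M k) x.
Proof.
move=> hx; apply: contrapT => nkx.
suff /le_std[j] : rel2 leN x (std M k) by apply: hx.
have h : forall x, sat (Fimp (Fnot (R2 leN (T0 1 k) (V 1 0)))
    (R2 leN (V 1 0) (T0 1 k))) [tuple x].
  apply: transfer1 => a; rewrite !satE !satN /tnth /= /leN => /negP.
  by rewrite -ltnNge => /ltnW.
by move: (h x); rewrite !satE /tnth /=; apply.
Qed.

Lemma nonstd_log b x : 1 < b -> nonstd x -> nonstd (app1 (trunc_log b) x).
Proof.
move=> b1 hx j xj; suff /le_std[i] : rel2 leN x (std M (b ^ j.+1)) by apply: hx.
have h : forall x, sat (Fimp (Feq (T1 (trunc_log b) (V 1 0)) (T0 1 j))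
    (R2 leN (V 1 0) (T0 1 (b ^ j.+1)))) [tuple x].
  apply: transfer1 => a; rewrite !satE !satN /tnth /= /leN => <-.
  by apply/ltnW/trunc_log_ltn.
by move: (h x); rewrite !satE /tnth /=; apply.
Qed.

Lemma nonstd_half x : nonstd x -> nonstd (app1 half x).
Proof.
move=> hx j xj; suff /le_std[i] : rel2 leN x (std M j.*2.+1) by apply: hx.
have h : forall x, sat (Fimp (Feq (T1 half (V 1 0)) (T0 1 j))
    (R2 leN (V 1 0) (T0 1 j.*2.+1))) [tuple x].
  apply: transfer1 => a; rewrite !satE !satN /tnth /= /leN => <-.
  by rewrite -{1}(odd_double_half a) -add1n leq_add2r; case: odd.
by move: (h x); rewrite !satE /tnth /=; apply.
Qed.

Lemma nonstd_min x y : nonstd x -> nonstd y -> nonstd (app2 minn x y).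
Proof.
move=> hx hy j xyj.
have h : forall x y, sat (Fimp (Fnot (Feq (T2 minn (V 2 0) (V 2 1)) (V 2 0)))
    (Feq (T2 minn (V 2 0) (V 2 1)) (V 2 1))) [tuple x; y].
  apply: transfer2 => a b; rewrite !satE !satN /tnth /= /minn.
  by case: ltnP.
move: (h x y); rewrite !satE /tnth /= xyj.
have [jx|nx] := pselect (std M j = x); first by have := hx j (esym jx).
by move=> /(_ nx) jy; have := hy j (esym jy).
Qed.

Lemma bound_std n k : nonstd n ->
  rel2 leN (std M k) (app2 boundN n (app1 (trunc_log k.+2) n)).
Proof.
move=> hn; have h : forall n, sat (Fimp (R2 leN (T0 1 k.+2) (V 1 0))
   (R2 leN (T0 1 k) (T2 boundN (V 1 0) (T1 (trunc_log k.+2) (V 1 0)))))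
   [tuple n].
  apply: transfer1 => a; rewrite !satE !satN /tnth /= /leN => ka.
  apply: (@leq_trans (2 ^ k)); first exact/ltnW/ltn_expl.
  rewrite leq_exp2l//; apply: (@leq_trans k.+2); first by do 2 apply/ltnW.
  by apply: leq_root => //; apply: trunc_logP => //; apply: leq_trans ka.
by move: (h n); rewrite !satE /tnth /=; apply; apply: nonstd_ge.
Qed.

Lemma bound_add n t t' x y :
  let s := app2 minn (app2 minn t t') (app1 (trunc_log 2) n) in
  rel2 leN (std M 2) s ->
  rel2 leN x (app2 boundN n t) -> rel2 leN y (app2 boundN n t') ->
  rel2 leN (app2 addn x y) (app2 boundN n (app1 half s)).
Proof.
pose s := T2 minn (T2 minn (V 5 1) (V 5 2)) (T1 (trunc_log 2) (V 5 0)).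
have h : forall n t t' x y, sat (Fimp (R2 leN (T0 5 2) s)
   (Fimp (R2 leN (V 5 3) (T2 boundN (V 5 0) (V 5 1)))
   (Fimp (R2 leN (V 5 4) (T2 boundN (V 5 0) (V 5 2)))
     (R2 leN (T2 addn (V 5 3) (V 5 4)) (T2 boundN (V 5 0) (T1 half s))))))
   [tuple n; t; t'; x; y].
  apply: transfer5 => a b c d e; rewrite !satE !satN /tnth /= /leN.
  set m := minn (minn b c) _ => m2 db ec.
  have ml : m <= trunc_log 2 a by apply: geq_minr.
  have mb : m <= b by apply: leq_trans (geq_minl _ _) (geq_minl _ _).
  have mc : m <= c by apply: leq_trans (geq_minl _ _) (geq_minr _ _).
  have a0 : 0 < a by move: (leq_trans m2 ml); case: (a); rewrite ?trunc_log0.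
  have ma : 2 ^ m <= a.
    by apply: leq_trans (@trunc_logP 2 a isT a0); rewrite leq_exp2l.
  apply: leq_trans (leq_add db ec) _.
  apply: (@leq_trans (2 ^ root a m + 2 ^ root a m)).
    by apply: leq_add; rewrite /boundN leq_exp2l//; apply: root_le => //;
      apply: leq_trans m2.
  by rewrite addnn -mul2n -expnS /boundN leq_exp2l//; apply: rootS.
by move: (h n t t' x y); rewrite !satE /tnth.
Qed.

Lemma leaf_wf n m :
  rel2 wf_treeN n (app1 leaf_code m).
Proof.
have h : forall n m, sat (R2 wf_treeN
    (V 2 0) (T1 leaf_code (V 2 1))) [tuple n; m].
  apply: transfer2 => a b; rewrite !satE !satN /tnth /=.
  by rewrite /wf_treeN /leafN /depthN /runN /tree_of_code choice.pickleK.
by move: (h n m); rewrite !satE /tnth.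
Qed.

Lemma leaf_leaves a m :
  rel2 leafN a (app1 leaf_code m) -> a = m.
Proof.
have h : forall a m, sat (Fimp (R2 leafN
    (V 2 0) (T1 leaf_code (V 2 1))) (Feq (V 2 0) (V 2 1))) [tuple a; m].
  apply: transfer2 => x b; rewrite !satE !satN /tnth /=.
  by rewrite /wf_treeN /leafN /depthN /runN /tree_of_code choice.pickleK inE => /eqP.
by move: (h a m); rewrite !satE /tnth.
Qed.

Lemma leaf_depth m b :
  rel2 leN (app1 depthN (app1 leaf_code m)) b.
Proof.
have h : forall m b, sat (R2 leN (T1 depthN
    (T1 leaf_code (V 2 0))) (V 2 1)) [tuple m; b].
  apply: transfer2 => x y; rewrite !satE !satN /tnth /=.
  by rewrite /wf_treeN /leafN /depthN /runN /tree_of_code choice.pickleK.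
by move: (h m b); rewrite !satE /tnth.
Qed.

Lemma leaf_run m w :
  m = app2 runN (app1 leaf_code m) w.
Proof.
have h : forall m w, sat (Feq (V 2 0) (T2 runN
    (T1 leaf_code (V 2 0)) (V 2 1))) [tuple m; w].
  apply: transfer2 => x y; rewrite !satE !satN /tnth /=.
  by rewrite /wf_treeN /leafN /depthN /runN /tree_of_code choice.pickleK.
by move: (h m w); rewrite !satE /tnth.
Qed.

End Transfer.

Section Events.
Variable S : setting.

Definition Mn_code : S := app1 structures (idx S).

(* The sample space M_{n, n/2}. *)
Definition Omega : Type := {w : S | rel2 memN w Mn_code}.

Definition codes_event (s : S) (A : set Omega) : Prop :=
  forall x : S, rel2 memN x s <-> exists2 w : Omega, A w & sval w = x.

Definition coded (A : set Omega) : Prop := exists s, codes_event s A.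

Definition infinitesimal (A : set Omega) : Prop :=
  exists2 s, codes_event s A &
    forall k, 0 < k -> rel3 ratio_lt s Mn_code (std S k).

Record event := Event { event_set :> set Omega; eventP : coded event_set }.

HB.instance Definition _ := gen_eqMixin event.
HB.instance Definition _ := gen_choiceMixin event.

Lemma event_inj : injective event_set.
Proof.
by case=> A hA [B hB] /= AB; subst B; rewrite (Prop_irrelevance hA hB).
Qed.

Lemma codedT : coded setT.
Proof.
exists Mn_code => x; split=> [h|[w _ <-]]; last exact: (svalP w).
by exists (exist _ x h).
Qed.

Lemma codes_eventD s t A B : codes_event s A -> codes_event t B ->
  codes_event (app2 diffN s t) (A `\` B).
Proof.
move=> hs ht x; rewrite (mem_diff (@model_true S)) hs ht; split.
  move=> [[w Aw <-] nB]; exists w => //; split=> // Bw.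
  by apply: nB; exists w.
move=> [w [Aw nBw] <-]; split; first by exists w.
by move=> [w' Bw' /eq_sig_hprop ww']; apply: nBw; rewrite -ww'.
Qed.

Lemma codes_eventU s t A B : codes_event s A -> codes_event t B ->
  codes_event (app2 unionN s t) (A `|` B).
Proof.
move=> hs ht x; rewrite (mem_union (@model_true S)) hs ht; split.
  by move=> [[w Aw <-]|[w Bw <-]]; exists w => //; [left|right].
by move=> [w [Aw|Bw] <-]; [left|right]; exists w.
Qed.

Lemma codedD A B : coded A -> coded B -> coded (A `\` B).
Proof.
by move=> [s hs] [t ht]; exists (app2 diffN s t); apply: codes_eventD.
Qed.

Lemma codedU A B : coded A -> coded B -> coded (A `|` B).
Proof.
by move=> [s hs] [t ht]; exists (app2 unionN s t); apply: codes_eventU.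
Qed.

Lemma codedC A : coded A -> coded (~` A).
Proof. by move=> hA; rewrite -setTD; apply: codedD => //; apply: codedT. Qed.

Lemma codedI A B : coded A -> coded B -> coded (A `&` B).
Proof. by move=> hA hB; rewrite -setDD; do 2 apply: codedD => //. Qed.

Lemma coded0 : coded set0.
Proof. by rewrite -setCT; apply/codedC/codedT. Qed.

Lemma infinitesimal0 : infinitesimal set0.
Proof.
have [s hs] := coded0; exists s => // k k0.
by apply: (ratio_empty (@model_true S)) => // x /hs[].
Qed.

Lemma infinitesimalU A B :
  infinitesimal A -> infinitesimal B -> infinitesimal (A `|` B).
Proof.
move=> [s hs is_] [t ht it]; exists (app2 unionN s t).
  exact: codes_eventU.
move=> k k0; apply: (ratio_union (@model_true S));
  rewrite (app1_std (@model_true S)); [apply: is_|apply: it];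
  by rewrite double_gt0.
Qed.

Lemma infinitesimalS A B :
  coded A -> A `<=` B -> infinitesimal B -> infinitesimal A.
Proof.
move=> [s hs] AB [t ht it]; exists s => // k k0.
apply: (mem_sub_ratio (@model_true S)) (it k k0) => x /hs[w Aw <-].
by apply/ht; exists w => //; apply: AB.
Qed.

Definition event_eq (A B : event) : bool := `[< infinitesimal (A `+` B) >].

Lemma codedY A B : coded A -> coded B -> coded (A `+` B).
Proof. by move=> hA hB; apply: codedU; apply: codedD. Qed.

Lemma event_eq_refl : reflexive event_eq.
Proof. by move=> A; apply/asboolP; rewrite setYK; apply: infinitesimal0. Qed.

Lemma event_eq_sym : symmetric event_eq.
Proof. by move=> A B; rewrite /event_eq setYC. Qed.

Lemma event_eq_trans : transitive event_eq.
Proof.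
move=> B A C /asboolP AB /asboolP BC; apply/asboolP.
apply: infinitesimalS (infinitesimalU AB BC).
  by apply: codedY; apply: eventP.
move=> w /= [[Aw nC]|[Cw nA]].
  by have [Bw|nB] := pselect (event_set B w); [right; left|left; left].
by have [Bw|nB] := pselect (event_set B w); [left; right|right; right].
Qed.

Canonical event_equiv :=
  EquivRel event_eq event_eq_refl event_eq_sym event_eq_trans.

Definition balg : Type := {eq_quot event_equiv}%qT.
HB.instance Definition _ := Choice.on balg.
HB.instance Definition _ := EqQuotient.on balg.

Local Open Scope quotient_scope.

Definition eventU (A B : event) : event :=
  Event (codedU (eventP A) (eventP B)).
Definition eventI (A B : event) : event :=
  Event (codedI (eventP A) (eventP B)).
Definition eventC (A : event) : event := Event (codedC (eventP A)).
Definition event0 : event := Event coded0.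
Definition eventT : event := Event codedT.

Definition balg_meet (b c : balg) : balg := \pi_balg (eventI (repr b) (repr c)).
Definition balg_join (b c : balg) : balg := \pi_balg (eventU (repr b) (repr c)).
Definition balg_compl (b : balg) : balg := \pi_balg (eventC (repr b)).

Lemma pi_eventP (A B : event) :
  infinitesimal (A `+` B) <-> \pi_balg A = \pi_balg B.
Proof.
by split=> [h|/eqquotP/asboolP//]; apply/eqquotP/asboolP.
Qed.

Lemma reprY (A : event) : infinitesimal (A `+` repr (\pi_balg A)).
Proof. by apply/pi_eventP; rewrite reprK. Qed.

Lemma balg_meetE A B : balg_meet (\pi_balg A) (\pi_balg B) = \pi_balg (eventI A B).
Proof.
apply/esym/pi_eventP; apply: infinitesimalS (infinitesimalU (reprY A) (reprY B)).
  by apply: codedY; apply: eventP.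
move: (repr (\pi_balg A)) (repr (\pi_balg B)) => A' B' w /= [[[Aw Bw] n]|[[Aw Bw] n]].
  have [A'w|nh] := pselect (event_set A' w); last by left; left.
  have [B'w|nh] := pselect (event_set B' w); last by right; left.
  by case: n.
have [A'w|nh] := pselect (event_set A w); last by left; right.
have [B'w|nh] := pselect (event_set B w); last by right; right.
by case: n.
Qed.

Lemma balg_complE A : balg_compl (\pi_balg A) = \pi_balg (eventC A).
Proof.
apply/esym/pi_eventP; apply: infinitesimalS (reprY A).
  by apply: codedY; apply: eventP.
move: (repr _) => A' w /= [[nA n]|[nA n]].
  by right; split=> //; apply: contrapT.
by left; split=> //; apply: contrapT.
Qed.

Lemma balg_joinE A B : balg_join (\pi_balg A) (\pi_balg B) = \pi_balg (eventU A B).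
Proof.
apply/esym/pi_eventP; apply: infinitesimalS (infinitesimalU (reprY A) (reprY B)).
  by apply: codedY; apply: eventP.
move: (repr (\pi_balg A)) (repr (\pi_balg B)) => A' B' w /= [[[Aw|Bw] n]|[[Aw|Bw] n]].
- by left; left; split=> // h; apply: n; left.
- by right; left; split=> // h; apply: n; right.
- by left; right; split=> // h; apply: n; left.
- by right; right; split=> // h; apply: n; right.
Qed.

Lemma balg_ind (P : balg -> Prop) : (forall A, P (\pi_balg A)) -> forall b, P b.
Proof. by move=> h b; rewrite -(reprK b); apply: h. Qed.

Let E := (balg_meetE, balg_joinE, balg_complE).

Fact balg_display : Order.disp_t. Proof. exact: Order.Disp tt tt. Qed.

Lemma balg_meetC : commutative balg_meet.
Proof.
elim/balg_ind=> A; elim/balg_ind=> B; rewrite !E; congr (\pi_balg _).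
by apply: event_inj; apply: setIC.
Qed.
Lemma balg_joinC : commutative balg_join.
Proof.
elim/balg_ind=> A; elim/balg_ind=> B; rewrite !E; congr (\pi_balg _).
by apply: event_inj; apply: setUC.
Qed.
Lemma balg_meetA : associative balg_meet.
Proof.
elim/balg_ind=> A; elim/balg_ind=> B; elim/balg_ind=> C; rewrite !E; congr (\pi_balg _).
by apply: event_inj; apply: setIA.
Qed.
Lemma balg_joinA : associative balg_join.
Proof.
elim/balg_ind=> A; elim/balg_ind=> B; elim/balg_ind=> C; rewrite !E; congr (\pi_balg _).
by apply: event_inj; apply: setUA.
Qed.
Lemma balg_joinKI : forall c b, balg_meet b (balg_join b c) = b.
Proof.
elim/balg_ind=> A; elim/balg_ind=> B; rewrite !E; congr (\pi_balg _).
by apply: event_inj; rewrite /= setIUr setIid; apply/setUidPl => w [].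
Qed.
Lemma balg_meetKU : forall c b, balg_join b (balg_meet b c) = b.
Proof.
elim/balg_ind=> A; elim/balg_ind=> B; rewrite !E; congr (\pi_balg _).
by apply: event_inj; apply/setUidPl => w [].
Qed.
Lemma balg_meetUl : left_distributive balg_meet balg_join.
Proof.
elim/balg_ind=> A; elim/balg_ind=> B; elim/balg_ind=> C; rewrite !E; congr (\pi_balg _).
by apply: event_inj; apply: setIUl.
Qed.
Lemma balg_meetxx : idempotent_op balg_meet.
Proof.
elim/balg_ind=> A; rewrite !E; congr (\pi_balg _); by apply: event_inj; apply: setIid.
Qed.

HB.instance Definition _ := Order.isMeetJoinDistrLattice.Build balg_display balg
  (fun _ _ => erefl) (fun _ _ => erefl) balg_meetC balg_joinC balg_meetA
  balg_joinA balg_joinKI balg_meetKU balg_meetUl balg_meetxx.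

Lemma balg_le0x (b : balg) : (\pi_balg event0 <= b :> balg)%O.
Proof.
elim/balg_ind: b => A; rewrite leEmeet [(_ `&` _)%O]balg_meetE; apply/eqP.
by congr (\pi_balg _); apply: event_inj; apply: set0I.
Qed.
Lemma balg_lex1 (b : balg) : (b <= \pi_balg eventT :> balg)%O.
Proof.
elim/balg_ind: b => A; rewrite leEmeet [(_ `&` _)%O]balg_meetE; apply/eqP.
by congr (\pi_balg _); apply: event_inj; apply: setIT.
Qed.
HB.instance Definition _ := Order.hasBottom.Build balg_display balg balg_le0x.
HB.instance Definition _ := Order.hasTop.Build balg_display balg balg_lex1.

Lemma balg_joinxC (b : balg) : (b `|` balg_compl b)%O = \top%O.
Proof.
elim/balg_ind: b => A; rewrite balg_complE [LHS]balg_joinE.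
by congr (\pi_balg _); apply: event_inj; apply: setUCr.
Qed.
Lemma balg_meetxC (b : balg) : (b `&` balg_compl b)%O = \bot%O.
Proof.
elim/balg_ind: b => A; rewrite balg_complE [LHS]balg_meetE.
by congr (\pi_balg _); apply: event_inj; apply: setICr.
Qed.
HB.instance Definition _ := Order.TBDistrLattice_hasComplement.Build
  balg_display balg balg_joinxC balg_meetxC.

(* The class of a set of samples; [\bot] is a dummy value for sets which are
   not coded in the model. The sets attached to atomic formulas of number sort
   are all coded. *)
Definition event_class (A : set Omega) : balg :=
  if pselect (coded A) is left h then \pi_balg (Event h) else \bot%O.

End Events.

Section Cut.
Variable S : setting.

(* The numbers bounded by 2 ^ (n ^ (1 / t)) for some nonstandard t; rounding
   the exponent down does not change this cut. *)
Definition inMn (x : S) : Prop :=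
  exists2 t : S, nonstd t &
    rel2 leN x (app2 boundN (idx S) t).

(* The function symbols of L_n; all relation symbols belong to L_n. *)
Definition Lnfun (a : nat) : Type :=
  {f : a.-tuple nat -> nat |
    forall v : a.-tuple S, (forall i, inMn (tnth v i)) -> inMn (funI f v)}.

Lemma inMn_std k : inMn (std S k).
Proof.
exists (app1 (trunc_log k.+2) (idx S)).
  by apply: (nonstd_log (@model_true S)) => //; apply: idx_nonstd.
by apply: (bound_std (@model_true S)); apply: idx_nonstd.
Qed.

Lemma inMn_add (x y : S) : inMn x -> inMn y -> inMn (app2 addn x y).
Proof.
move=> [t ht xt] [t' ht' yt']; have HM := @model_true S.
pose s := app2 minn (app2 minn t t') (app1 (trunc_log 2) (idx S)).
have hs : nonstd s.
  apply: (nonstd_min HM); first exact: (nonstd_min HM).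
  by apply: (nonstd_log HM) => //; apply: idx_nonstd.
exists (app1 half s); first exact: (nonstd_half HM).
by apply: (bound_add HM) xt yt'; apply: (nonstd_ge HM).
Qed.

Definition Ln_const (c : nat) : Lnfun 0.
Proof.
exists (fun=> c) => v _; rewrite (tuple0 v); exact: (inMn_std c).
Defined.

Definition Ln_add : Lnfun 2.
Proof.
exists (fun t : 2.-tuple nat => [tnth t 0] + [tnth t 1]) => v hv.
have -> : v = [tuple tnth v ord0; tnth v ord_max].
  by apply: eq_from_tnth => -[[|[|//]] hi];
    rewrite [RHS]/tnth /=; congr tnth; apply: val_inj.
exact: inMn_add.
Defined.

End Cut.

Section Random.
Variable S : setting.
Local Notation Om := (Omega S).

Definition runM (T w : S) : S := app2 runN T w.

Definition inTnb (T : S) : Prop :=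
  [/\ rel2 wf_treeN (idx S) T,
      forall a : S, rel2 leafN a T ->
        inMn a
    & exists2 t : S, nonstd t &
        rel2 leN (app1 depthN T)
          (app2 root (idx S) t)].

Definition Fnb : Type :=
  {f : Om -> S | exists2 T, inTnb T & forall w, f w = runM T (sval w)}.

Definition rvar (f : Fnb) : Om -> S := sval f.
Coercion rvar : Fnb >-> Funclass.

(* A partial function is coded by the set of the pairs <<x>, f x>. *)
Definition codes_pfun k (c : S) (f : k.-tuple S -> option S) : Prop :=
  forall x, rel2 memN x c <->
    exists v y, f v = Some y /\ x = app2 cpair (funI (@ctuple k) v) y.

Record rfun (k : nat) := Rfun {
  rfun_at :> Om -> k.-tuple S -> option S;
  rfun_coded : forall w, exists c, codes_pfun c (rfun_at w);
  rfun_Mn : forall w v y, rfun_at w v = Some y ->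
    (forall i, inMn (tnth v i)) /\ inMn y }.

Definition rapply k (F : rfun k) (w : Om) (v : k.-tuple S) : S :=
  odflt (std S 0) (F w v).

Definition codes_fun (c : S) (f : Om -> S) : Prop :=
  forall x, rel2 memN x c <-> exists w, x = app2 cpair (sval w) (f w).

(* [g] codes the tuple of the [gamma i] for i below the length of [g]; the
   other values of [gamma] are irrelevant. *)
Definition coded_seq (g : S) (gamma : S -> Fnb) : Prop :=
  forall i, rel2 ltN i (app1 lenN g) -> codes_fun (app2 nthN g i) (gamma i).

(* (x_0, ..., x_k, x_(k+1)) |-> (x_0, ..., x_(k-1), <x_k, x_(k+1)>) *)
Definition pair_last k (v : k.+2.-tuple S) : k.+1.-tuple S :=
  [tuple if i == ord_max
         then app2 cpair (tnth v (lift ord_max ord_max)) (tnth v ord_max)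
         else tnth v (lift ord_max i) | i < k.+1].

Definition at_sample k (alpha : 'I_k -> Fnb) (w : Om) : k.-tuple S :=
  [tuple alpha i w | i < k].

Fixpoint inGnb (k : nat) : rfun k.+1 -> Prop :=
  match k with
  | 0 => fun F => exists (g : S) (gamma : S -> Fnb),
      [/\ inMn (app1 lenN g), coded_seq g gamma
        & forall (alpha : Fnb) w, rapply F w [tuple alpha w] =
            if pselect (rel2 ltN (alpha w) (app1 lenN g))
            then gamma (alpha w) w else std S 0]
  | k'.+1 => fun F => exists2 F' : rfun k'.+1, inGnb F' &
      forall (alpha : 'I_k'.+2 -> Fnb) w,
        rapply F w (at_sample alpha w) =
        rapply F' w (pair_last (at_sample alpha w))
  end.

(* The members of G_nb of arity k + 1. *)
Definition Gnb (k : nat) : Type := {F : rfun k.+1 | inGnb F}.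

Lemma cst_subproof (m : S) : inMn m ->
  exists2 T, inTnb T & forall w : Om, m = runM T (sval w).
Proof.
move=> hm; have HM := @model_true S; exists (app1 leaf_code m).
  split; first exact: (leaf_wf HM).
    by move=> a /(leaf_leaves HM) ->.
  by exists (idx S); [apply: idx_nonstd|apply: (leaf_depth HM)].
by move=> w; apply: (leaf_run HM).
Qed.

Definition cst (m : S) (hm : inMn m) : Fnb :=
  exist _ (fun=> m) (cst_subproof hm).

End Random.

(* Typed de Bruijn variables of set sort: [s] lists the variables in scope,
   an entry [a] standing for a variable of arity [a.+1]. *)
Inductive svar : seq nat -> nat -> Type :=
| SZ a s : svar (a :: s) a
| SS b s a : svar s a -> svar (b :: s) a.
Arguments SZ {a s}.
Arguments SS {b s a} _.

Definition ncons (T : Type) k (x : T) (u : 'I_k -> T) (i : 'I_k.+1) : T :=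
  if unlift ord0 i is Some j then u j else x.

Definition scons (T : nat -> Type) a s (x : T a) (u : forall b, svar s b -> T b)
    (b : nat) (v : svar (a :: s) b) : T b :=
  match v in svar (a' :: s') b'
    return T a' -> (forall c, svar s' c -> T c) -> T b' with
  | SZ _ _ => fun x _ => x
  | SS _ _ _ v' => fun _ u => u _ v'
  end x u.

Section Language.
Variable S : setting.

Inductive sterm (s : seq nat) (a : nat) : Type :=
| SVar of svar s a
| SPar of Gnb S a.

Inductive nterm (s : seq nat) (k : nat) : Type :=
| NVar of 'I_k
| NPar of Fnb S
| NFun a of Lnfun S a & ('I_a -> nterm s k)
| NApp a of sterm s a & ('I_a.+1 -> nterm s k).

Inductive lform : seq nat -> nat -> Type :=
| Rel s k a of (a.-tuple nat -> Prop) & ('I_a -> nterm s k) : lform s k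
| Eqn s k of nterm s k & nterm s k : lform s k
| Eqs s k a of sterm s a & sterm s a : lform s k
| Not s k of lform s k : lform s k
| And s k of lform s k & lform s k : lform s k
| Or s k of lform s k & lform s k : lform s k
| All s k of lform s k.+1 : lform s k
| Ex s k of lform s k.+1 : lform s k
| All2 s k a of lform (a :: s) k : lform s k
| Ex2 s k a of lform (a :: s) k : lform s k.

Fixpoint is_open s k (p : lform s k) : bool :=
  match p with
  | Rel _ _ _ _ _ | Eqn _ _ _ _ | Eqs _ _ _ _ _ => true
  | Not _ _ q => is_open q
  | And _ _ q r | Or _ _ q r => is_open q && is_open r
  | All _ _ _ | Ex _ _ _ | All2 _ _ _ _ | Ex2 _ _ _ _ => false
  end.

Definition sren s s' := forall a, svar s a -> svar s' a.

Definition ssubst s s' (rho : sren s s') a (X : sterm s a) : sterm s' a :=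
  match X with SVar v => SVar (rho a v) | SPar F => SPar _ F end.

Fixpoint nsubst s s' (rho : sren s s') k k' (sigma : 'I_k -> nterm s' k')
    (t : nterm s k) : nterm s' k' :=
  match t with
  | NVar i => sigma i
  | NPar f => NPar _ _ f
  | NFun a f ts => NFun f (fun i => nsubst rho sigma (ts i))
  | NApp a X ts => NApp (ssubst rho X) (fun i => nsubst rho sigma (ts i))
  end.

Definition sid s : sren s s := fun _ v => v.
Definition sshift b s : sren s (b :: s) := fun _ v => SS v.
Definition slift s s' (rho : sren s s') b : sren (b :: s) (b :: s') :=
  scons (T := svar (b :: s')) SZ (fun a v => SS (rho a v)).

Definition nlift s k k' (sigma : 'I_k -> nterm s k') : 'I_k.+1 -> nterm s k'.+1 :=
  ncons (NVar _ ord0)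
    (fun i => nsubst (@sid s) (fun j => NVar _ (lift ord0 j)) (sigma i)).
Definition nweak s (b : nat) k k' (sigma : 'I_k -> nterm s k') :
    'I_k -> nterm (b :: s) k' :=
  fun i => nsubst (@sshift b s) (@NVar _ _) (sigma i).

Fixpoint subst s k (p : lform s k) : forall s' (rho : sren s s') k'
    (sigma : 'I_k -> nterm s' k'), lform s' k' :=
  match p with
  | Rel _ _ _ R ts => fun _ rho _ sigma =>
      Rel R (fun i => nsubst rho sigma (ts i))
  | Eqn _ _ t u => fun _ rho _ sigma =>
      Eqn (nsubst rho sigma t) (nsubst rho sigma u)
  | Eqs _ _ _ X Y => fun _ rho _ _ => Eqs _ (ssubst rho X) (ssubst rho Y)
  | Not _ _ q => fun _ rho _ sigma => Not (subst q rho sigma)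
  | And _ _ q r => fun _ rho _ sigma =>
      And (subst q rho sigma) (subst r rho sigma)
  | Or _ _ q r => fun _ rho _ sigma =>
      Or (subst q rho sigma) (subst r rho sigma)
  | All _ _ q => fun _ rho _ sigma => All (subst q rho (nlift sigma))
  | Ex _ _ q => fun _ rho _ sigma => Ex (subst q rho (nlift sigma))
  | All2 _ _ a q => fun _ rho _ sigma =>
      All2 (subst q (@slift _ _ rho a) (nweak a sigma))
  | Ex2 _ _ a q => fun _ rho _ sigma =>
      Ex2 (subst q (@slift _ _ rho a) (nweak a sigma))
  end.

Definition senv (s : seq nat) := forall a, svar s a -> Gnb S a.

Definition evals s (U : senv s) a (X : sterm s a) : rfun S a.+1 :=
  match X with SVar v => sval (U a v) | SPar F => sval F end.

(* A term evaluates to a plain function on the sample space, which in fact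
   belongs to F_nb. *)
Fixpoint evaln s k (U : senv s) (u : k.-tuple (Fnb S)) (t : nterm s k) :
    Omega S -> S :=
  match t with
  | NVar i => tnth u i
  | NPar f => f
  | NFun a f ts => fun w => funI (sval f) [tuple evaln U u (ts i) w | i < a]
  | NApp a X ts => fun w =>
      rapply (evals U X) w [tuple evaln U u (ts i) w | i < a.+1]
  end.

(* The infima and suprema exist: [balg S] is complete because the model is
   aleph_1-saturated. *)
Fixpoint truth s k (p : lform s k) : senv s -> k.-tuple (Fnb S) -> balg S :=
  match p with
  | Rel _ _ a R ts => fun U u =>
      event_class [set w | relI R [tuple evaln U u (ts i) w | i < a]]
  | Eqn _ _ t t' => fun U u => event_class [set w | evaln U u t w = evaln U u t' w]
  | Eqs _ _ _ X Y => fun U _ => event_class [set w | evals U X w = evals U Y w]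
  | Not _ _ q => fun U u => (~` truth q U u)%O
  | And _ _ q r => fun U u => (truth q U u `&` truth r U u)%O
  | Or _ _ q r => fun U u => (truth q U u `|` truth r U u)%O
  | All _ _ q => fun U u =>
      infimum \top%O (range (fun f : Fnb S => truth q U [tuple of f :: u]))
  | Ex _ _ q => fun U u =>
      supremum \bot%O (range (fun f : Fnb S => truth q U [tuple of f :: u]))
  | All2 _ _ a q => fun U u =>
      infimum \top%O (range (fun F : Gnb S a => truth q (scons F U) u))
  | Ex2 _ _ a q => fun U u =>
      supremum \bot%O (range (fun F : Gnb S a => truth q (scons F U) u))
  end.

Definition sentence := lform [::] 0.

Definition senv0 : senv [::] := fun a v => match v with end.

Definition valid (p : sentence) : Prop := truth p senv0 [tuple] = \top%O.

Definition Imp s k (p q : lform s k) : lform s k := Or (Not p) q.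
Definition Iff s k (p q : lform s k) : lform s k := And (Imp p q) (Imp q p).
Definition num s k (c : nat) : nterm s k :=
  NFun (Ln_const S c) (fun i => NVar _ (widen_ord (leq0n k) i)).
Definition add s k (t u : nterm s k) : nterm s k :=
  NFun (Ln_add S) (tnth [tuple t; u]).
Definition Lt s k (t u : nterm s k) : lform s k :=
  Rel (fun v : 2.-tuple nat => [tnth v 0] < [tnth v 1]) (tnth [tuple t; u]).
Definition Mem s k (X : sterm s 0) (t : nterm s k) : lform s k :=
  Not (Eqn (NApp X (fun=> t)) (num s k 0)).

(* For [p] a formula with a single free variable x of number sort. *)
Definition at_term k (p : lform [::] 1) s (t : nterm s k) : lform s k :=
  subst p (fun a v => match v with end) (fun=> t).

Definition open_comprehension (p : lform [::] 1) (m : Fnb S) : sentence :=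
  let y := NVar [:: 0] ord0 in
  Ex2 (All (Imp (Lt y (NPar _ _ m)) (Iff (Mem (SVar SZ) y) (at_term p y)))).

Definition open_induction (p : lform [::] 1) (m : Fnb S) : sentence :=
  let x := NVar [::] ord0 in
  Or (Not (at_term p (num _ _ 0)))
    (Or (at_term p (NPar _ _ m))
      (Ex (And (Lt x (NPar _ _ m))
        (And (at_term p x) (Not (at_term p (add x (num _ _ 1)))))))).

End Language.

(* Main.v *)
From mathcomp Require Import all_boot all_order all_algebra finmap.
From mathcomp Require Import generic_quotient zify.
From mathcomp Require Import mathcomp_extra boolp classical_sets cardinality.
Require Import Defs.

(** Everything is coded by decision trees whose depth lies in a cut closed
    under multiplication. Call a depth shallow when it is at most [n ^ (1 / t)]
    for some nonstandard [t]; shallow depths are closed under products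
    ([shallow_grow]), and [inMn] consists of the numbers at most [2 ^ d] with [d]
    shallow. Grafting trees onto the leaves of other trees adds depths, so the
    composite of boundedly many computations by shallow trees is again computed
    by a shallow tree.

    The central notion is that of a [uniform] family: a function [h w a] of a
    sample [w] and a number [a] such that, for every bound [b] in the cut, a
    single coded sequence of trees of one common shallow depth computes the
    functions [h ^~ a] with [a < b]. Uniform families are closed under
    composition and pairing, and contain the members of both sorts
    ([uniform_cst], [uniform_Gnb]); hence the value of any term at a sample [w]
    and an argument [a] is a uniform family ([uniform_peval]). The common depth
    in the case of a set-sort function is where nonstandardness enters: the
    least common bound for an internally coded sequence of trees is attained at
    some index, and is therefore shallow as soon as each tree is.

    An atomic formula of number sort is then decided, at every sample, by a
    uniform family with values nonzero or zero, and so are Boolean combinations.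
    Equality of two set-sort functions is different: its truth value is a fixed
    element [b] of the algebra which no shallow tree need decide. It does not
    depend on the variable, however, so it is constantly true on [b] and
    constantly false on the complement of [b]. Splitting the algebra finitely
    often in this way, one finds that an open formula is decided by a uniform
    family on each piece of a cover of the algebra ([decides_cover]), and it
    suffices to bound the truth value of each scheme below by every piece.

    On a piece where [h] decides the formula, comprehension is witnessed by the
    function [h] cut off at [m] ([cut_function]). Induction is witnessed by
    binary search: [m] is at most [2 ^ e] with [e] shallow, so a tree of depth
    the product of [e] and the depth of the trees of [h] finds a place below [m]
    where [h] changes from nonzero to zero ([sign_change]).

    The quantifiers are infima and suprema of possibly infinite sets of truth
    values. That the suprema exist is completeness of the algebra, which follows
    from saturation ([balg_sup]): the sets whose measure approximates the
    supremum of the measures from below have a common coded superset of the same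
    standard measure.

    Every internal step (existence of a grafted sequence of trees, of a code
    for a graph, of a least common depth) is an assertion about natural numbers
    carried over to the model by the tactic [transfer]. *)

Set Implicit Arguments.
Unset Strict Implicit.
Unset Printing Implicit Defensive.

Import Order.TTheory Order.CTheory GRing.Theory Num.Theory.

Local Open Scope nat_scope.
Local Open Scope classical_set_scope.

(** * The model as an elementary extension of the natural numbers *)

Section Transfer.
Variable S : setting.
Let HM := @model_true S.

Lemma relI_iff k (P Q : k.-tuple nat -> Prop) (v : k.-tuple S) :
  (forall u, P u <-> Q u) -> relI P v <-> relI Q v.
Proof. by move=> PQ; have -> : P = Q by apply/funext => u; apply/propext. Qed.

Lemma tuple_tnth (T : Type) k (v : k.-tuple T) : [tuple tnth v i | i < k] = v.
Proof. by apply: eq_from_tnth => i; rewrite tnth_mktuple. Qed.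

(** All relations on the natural numbers are symbols of the language, so each
    is interpreted in the model; the interpretation commutes with connectives,
    quantifiers and substitution, by the elementary equivalence of the model
    with the natural numbers. The lemmas below are the separate clauses. *)
Lemma relI_true k (P : k.-tuple nat -> Prop) (v : k.-tuple S) :
  (forall u, P u) -> relI P v.
Proof.
move=> hP; have := @transfer S HM k (Frel P (@Tvar k)).
move=> /(_ _ v); rewrite /= tuple_tnth; apply.
by move=> u; rewrite /= tuple_tnth; apply: hP.
Qed.

Lemma relI_not k (P : k.-tuple nat -> Prop) (v : k.-tuple S) :
  relI (fun u => ~ P u) v <-> ~ relI P v.
Proof.
pose p := Frel P (@Tvar k); pose q := Frel (fun u => ~ P u) (@Tvar k).
have := @transfer S HM k (Fand (Fimp q (Fnot p)) (Fimp (Fnot p) q)).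
move=> /(_ _ v); rewrite satand !satimp /= !tuple_tnth; apply.
by move=> u; rewrite /= !tuple_tnth; tauto.
Qed.

Lemma relI_and k (P Q : k.-tuple nat -> Prop) (v : k.-tuple S) :
  relI (fun u => P u /\ Q u) v <-> relI P v /\ relI Q v.
Proof.
pose p := Frel P (@Tvar k); pose q := Frel Q (@Tvar k).
pose r := Frel (fun u => P u /\ Q u) (@Tvar k).
have := @transfer S HM k (Fand (Fimp r (Fand p q)) (Fimp (Fand p q) r)).
move=> /(_ _ v); rewrite satand !satimp /= !tuple_tnth; apply.
by move=> u; rewrite /= !tuple_tnth; tauto.
Qed.

Lemma relI_all k (P : k.+1.-tuple nat -> Prop) (v : k.-tuple S) :
  relI (fun u => forall z, P (cons_tuple z u)) v <->
  forall z : S, relI P (cons_tuple z v).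
Proof.
pose p := Fall (Frel P (@Tvar k.+1)).
pose r := Frel (fun u => forall z, P (cons_tuple z u)) (@Tvar k).
have E (N : structure) (w : k.-tuple N) :
    sat p w = forall x, relI P (cons_tuple x w).
  rewrite /=; apply/propext.
  by split=> hx x; have := hx x; rewrite tuple_tnth.
have := @transfer S HM k (Fand (Fimp r p) (Fimp p r)).
move=> /(_ _ v); rewrite satand !satimp E /= tuple_tnth; apply=> u.
have /= -> := E stdN u.
by rewrite tuple_tnth; tauto.
Qed.

Lemma relI_comp k a (R : a.-tuple nat -> Prop) (f : 'I_a -> k.-tuple nat -> nat)
    (v : k.-tuple S) :
  relI (fun u => R [tuple f i u | i < a]) v <->
  relI R [tuple funI (f i) v | i < a].
Proof.
pose p := @Frel k a R (fun i => Tfun (f i) (@Tvar k)).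
pose r := Frel (fun u => R [tuple f i u | i < a]) (@Tvar k).
have := @transfer S HM k (Fand (Fimp r p) (Fimp p r)).
move=> /(_ _ v); rewrite satand !satimp /= !tuple_tnth.
by apply=> u /=; rewrite !tuple_tnth; tauto.
Qed.

Lemma funI_comp k a (g : a.-tuple nat -> nat) (f : 'I_a -> k.-tuple nat -> nat)
    (v : k.-tuple S) :
  funI (fun u => g [tuple f i u | i < a]) v =
  funI g [tuple funI (f i) v | i < a].
Proof.
have := @transfer S HM k (Feq (Tfun (fun u => g [tuple f i u | i < a]) (@Tvar k))
  (Tfun g (fun i => Tfun (f i) (@Tvar k)))).
move=> /(_ _ v); rewrite sateq /= !tuple_tnth; apply=> u.
by rewrite /= !tuple_tnth.
Qed.

Lemma funI_eq k (f g : k.-tuple nat -> nat) (v : k.-tuple S) :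
  relI (fun u => f u = g u) v <-> funI f v = funI g v.
Proof.
pose p := Frel (fun u => f u = g u) (@Tvar k).
pose q := Feq (Tfun f (@Tvar k)) (Tfun g (@Tvar k)).
have := @transfer S HM k (Fand (Fimp p q) (Fimp q p)).
move=> /(_ _ v); rewrite satand !satimp /= !tuple_tnth; apply.
by move=> u; rewrite /= !tuple_tnth; tauto.
Qed.

Lemma funI_proj k (i : 'I_k) (v : k.-tuple S) :
  funI (fun u => tnth u i) v = tnth v i.
Proof.
have := @transfer S HM k (Feq (Tfun (fun u => tnth u i) (@Tvar k)) (Tvar i)).
by move=> /(_ _ v); rewrite sateq /= !tuple_tnth; apply=> u; rewrite tuple_tnth.
Qed.

(** Reification of assertions about the model: in the environment [e], the
    element [x] is the value of the function [f], and the proposition [P] is the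
    interpretation of the relation [R]. Environments are lists on the model
    side, and [f] and [R] read their arguments from lists of numbers, so that
    binders are handled by consing. *)
Definition termdef (e : seq S) (x : S) (f : seq nat -> nat) :=
  x = funI (fun t : (size e).-tuple nat => f t) (in_tuple e).
Definition propdef (e : seq S) (P : Prop) (R : seq nat -> Prop) :=
  P <-> relI (fun t : (size e).-tuple nat => R t) (in_tuple e).

Existing Class termdef.
Existing Class propdef.

Section Composition.
Variable k : nat.

Lemma funI_cons (f : k.-tuple nat -> nat) x (v : k.-tuple S) :
  funI (fun u : k.+1.-tuple nat => f (behead_tuple u)) (cons_tuple x v)
  = funI f v.
Proof.
have := funI_comp f (fun i (u : k.+1.-tuple nat) => tnth u (lift ord0 i))
  (cons_tuple x v).
have E (u : k.+1.-tuple nat) : [tuple tnth u (lift ord0 i) | i < k] =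
   (behead_tuple u).
  by apply: eq_from_tnth => i; rewrite tnth_mktuple tnth_behead; congr tnth;
    apply: val_inj; rewrite /= inordK // ltnS.
have -> : (fun u : k.+1.-tuple nat => f [tuple tnth u (lift ord0 i) | i < k])
   = fun u => f (behead_tuple u) by apply/funext => u; rewrite E.
move=> ->; congr funI; apply: eq_from_tnth => i.
by rewrite tnth_mktuple funI_proj tnthS.
Qed.

Lemma funI_comp1 f (g : k.-tuple nat -> nat) (v : k.-tuple S) :
  funI (fun u => f (g u)) v = app1 f (funI g v).
Proof.
have := funI_comp (fun t : 1.-tuple nat => f [tnth t 0]) (fun=> g) v.
have -> : (fun u => f (g u)) = fun u => f [tnth [tuple g u | _ < 1] 0].
  by apply/funext => u; rewrite tnth_mktuple.
move=> ->; rewrite /app1; congr funI; apply: eq_from_tnth => i.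
by rewrite tnth_mktuple (ord1 i).
Qed.

Lemma funI_comp0 c (v : k.-tuple S) : funI (fun=> c) v = std S c.
Proof.
have := funI_comp (fun=> c) (fun (i : 'I_0) (u : k.-tuple nat) => 0) v.
by move=> ->; congr funI; apply: eq_from_tnth => -[].
Qed.

Lemma funI_comp2 f (g h : k.-tuple nat -> nat) (v : k.-tuple S) :
  funI (fun u => f (g u) (h u)) v = app2 f (funI g v) (funI h v).
Proof.
have := funI_comp (fun t : 2.-tuple nat => f [tnth t 0] [tnth t 1])
  (fun i => tnth [tuple g; h] i) v.
have -> : (fun u => f (g u) (h u)) = fun u =>
  f [tnth [tuple tnth [tuple g; h] i u | i < 2] 0]
    [tnth [tuple tnth [tuple g; h] i u | i < 2] 1].
  by apply/funext => u; rewrite !tnth_mktuple.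
move=> ->; rewrite /app2; congr funI; apply: eq_from_tnth => i.
by rewrite tnth_mktuple; case: i => [[|[|]]].
Qed.

Lemma relI_comp1 R (g : k.-tuple nat -> nat) (v : k.-tuple S) :
  relI (fun u => R (g u)) v <-> rel1 R (funI g v).
Proof.
have := relI_comp (fun t : 1.-tuple nat => R [tnth t 0]) (fun=> g) v.
have -> : (fun u => R (g u)) = fun u => R [tnth [tuple g u | _ < 1] 0].
  by apply/funext => u; rewrite tnth_mktuple.
move=> ->; rewrite /rel1.
have -> : [tuple funI g v | _ < 1] = [tuple funI g v].
  by apply: eq_from_tnth => i; rewrite tnth_mktuple (ord1 i).
by [].
Qed.

Lemma relI_comp2 R (g h : k.-tuple nat -> nat) (v : k.-tuple S) :
  relI (fun u => R (g u) (h u)) v <-> rel2 R (funI g v) (funI h v).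
Proof.
have := relI_comp (fun t : 2.-tuple nat => R [tnth t 0] [tnth t 1])
  (fun i => tnth [tuple g; h] i) v.
have -> : (fun u => R (g u) (h u)) = fun u =>
  R [tnth [tuple tnth [tuple g; h] i u | i < 2] 0]
    [tnth [tuple tnth [tuple g; h] i u | i < 2] 1].
  by apply/funext => u; rewrite !tnth_mktuple.
move=> ->; rewrite /rel2.
have -> : [tuple funI (tnth [tuple g; h] i) v | i < 2] = [tuple funI g v; funI h v].
  by apply: eq_from_tnth => i; rewrite tnth_mktuple; case: i => [[|[|]]].
by [].
Qed.

Lemma relI_comp3 R (g h l : k.-tuple nat -> nat) (v : k.-tuple S) :
  relI (fun u => R (g u) (h u) (l u)) v <->
  rel3 R (funI g v) (funI h v) (funI l v).
Proof.
have := relI_comp (fun t : 3.-tuple nat => R [tnth t 0] [tnth t 1] [tnth t 2])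
  (fun i => tnth [tuple g; h; l] i) v.
have -> : (fun u => R (g u) (h u) (l u)) = fun u =>
  R [tnth [tuple tnth [tuple g; h; l] i u | i < 3] 0]
    [tnth [tuple tnth [tuple g; h; l] i u | i < 3] 1]
    [tnth [tuple tnth [tuple g; h; l] i u | i < 3] 2].
  by apply/funext => u; rewrite !tnth_mktuple.
move=> ->; rewrite /rel3.
have -> : [tuple funI (tnth [tuple g; h; l] i) v | i < 3] =
   [tuple funI g v; funI h v; funI l v].
  by apply: eq_from_tnth => i; rewrite tnth_mktuple; case: i => [[|[|[|]]]].
by [].
Qed.

End Composition.

Section Instances.
Variable e : seq S.

Lemma termdef_hd x : termdef (x :: e) x (head 0).
Proof.
rewrite /termdef -[LHS](funI_proj ord0 (in_tuple (x :: e))).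
by congr funI; apply/funext => u; rewrite (tnth_nth 0) nth0.
Qed.

Lemma in_tuple_cons x : in_tuple (x :: e) = cons_tuple x (in_tuple e).
Proof. exact: val_inj. Qed.

Lemma termdef_tl x y f :
  termdef e y f -> termdef (x :: e) y (fun u => f (behead u)).
Proof.
move=> ->; rewrite /termdef in_tuple_cons.
exact: esym (funI_cons (fun t => f t) x (in_tuple e)).
Qed.

Global Instance termdef_std c : termdef e (std S c) (fun=> c).
Proof. by rewrite /termdef funI_comp0. Qed.

Global Instance termdef_app1 f x g :
  termdef e x g -> termdef e (app1 f x) (fun u => f (g u)).
Proof. by rewrite /termdef => ->; rewrite funI_comp1. Qed.

Global Instance termdef_app2 f x y g h :
  termdef e x g -> termdef e y h -> termdef e (app2 f x y) (fun u => f (g u) (h u)).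
Proof. by rewrite /termdef => -> ->; rewrite funI_comp2. Qed.

Global Instance propdef_rel1 R x g :
  termdef e x g -> propdef e (rel1 R x) (fun u => R (g u)).
Proof. by move=> ->; rewrite /propdef relI_comp1. Qed.

Global Instance propdef_rel2 R x y g h :
  termdef e x g -> termdef e y h ->
  propdef e (rel2 R x y) (fun u => R (g u) (h u)).
Proof. by move=> -> ->; rewrite /propdef relI_comp2. Qed.

Global Instance propdef_rel3 R x y z g h l :
  termdef e x g -> termdef e y h -> termdef e z l ->
  propdef e (rel3 R x y z) (fun u => R (g u) (h u) (l u)).
Proof. by move=> -> -> ->; rewrite /propdef relI_comp3. Qed.

Global Instance propdef_eq x y g h :
  termdef e x g -> termdef e y h -> propdef e (x = y) (fun u => g u = h u).
Proof. by move=> -> ->; rewrite /propdef funI_eq. Qed.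

Global Instance propdef_False : propdef e False (fun=> False).
Proof.
split=> // h; have : relI (fun t : (size e).-tuple nat => ~ False) (in_tuple e).
  by apply: relI_true => u [].
by rewrite relI_not.
Qed.

Global Instance propdef_not P R :
  propdef e P R -> propdef e (~ P) (fun u => ~ R u).
Proof. by rewrite /propdef => ->; rewrite relI_not. Qed.

Global Instance propdef_and P Q R T : propdef e P R -> propdef e Q T ->
  propdef e (P /\ Q) (fun u => R u /\ T u).
Proof. by rewrite /propdef => -> ->; rewrite relI_and. Qed.

(** Reduces the remaining connectives to negation and conjunction, since
    excluded middle holds on both sides. *)
Lemma propdef_iff_trans P Q R T : propdef e P R ->
  (P <-> Q) -> (forall u, R u <-> T u) -> propdef e Q T.
Proof.
move=> hP /propext <- RT; suff <- : R = T by [].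
by apply/funext => u; apply/propext.
Qed.

Global Instance propdef_imp P Q R T : propdef e P R -> propdef e Q T ->
  propdef e (P -> Q) (fun u => R u -> T u).
Proof.
move=> hP hQ; apply: propdef_iff_trans
  (propdef_not (propdef_and hP (propdef_not hQ))) _ _ => [|u].
  by have := EM Q; tauto.
by have := EM (T u); tauto.
Qed.

Global Instance propdef_or P Q R T : propdef e P R -> propdef e Q T ->
  propdef e (P \/ Q) (fun u => R u \/ T u).
Proof.
move=> hP hQ; apply: propdef_iff_trans
  (propdef_imp (propdef_not hP) hQ) _ _ => [|u].
  by have := EM P; tauto.
by have := EM (R u); tauto.
Qed.

Global Instance propdef_iff P Q R T : propdef e P R -> propdef e Q T ->
  propdef e (P <-> Q) (fun u => R u <-> T u).
Proof. by move=> hP hQ; apply: propdef_and; apply: propdef_imp. Qed.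

End Instances.

Global Instance propdef_all (e : seq S) (P : S -> Prop) R :
  (forall x : S, propdef (x :: e) (P x) R) ->
  propdef e (forall x : S, P x) (fun u => forall x : nat, R (x :: u)).
Proof.
move=> hP; rewrite /propdef.
apply: iff_trans (iff_sym (relI_all (fun v => R v) _)).
by split=> h x; [move/hP: (h x)|apply/hP]; rewrite in_tuple_cons.
Qed.

Global Instance propdef_ex (e : seq S) (P : S -> Prop) R :
  (forall x : S, propdef (x :: e) (P x) R) ->
  propdef e (exists x : S, P x) (fun u => exists x : nat, R (x :: u)).
Proof.
move=> hP; apply: propdef_iff_trans
  (propdef_not (propdef_all (fun x => propdef_not (hP x)))) _ _ => [|u];
  by rewrite -existsNP; split=> -[x hx]; exists x => //; apply: contrapT.
Qed.

Lemma transferP (P : Prop) (R : seq nat -> Prop) {h : propdef [::] P R} :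
  R [::] -> P.
Proof. by move=> r; apply/h/relI_true => u; rewrite (tuple0 u). Qed.

End Transfer.

#[global] Hint Mode propdef - - ! - : typeclass_instances.
(* Variables are looked up syntactically, so that these two rules are never
   tried on compound terms. *)
#[global] Hint Extern 0 (termdef (?x :: _) ?y _) =>
  is_var y; constr_eq x y; exact: termdef_hd : typeclass_instances.
#[global] Hint Extern 1 (termdef (?x :: _) ?y _) =>
  is_var y; apply: termdef_tl : typeclass_instances.

(** Replaces a closed assertion about the model by the same assertion about
    the natural numbers; all elements of the model that occur in it must have
    been generalized. *)
Ltac transfer := eapply transferP; [once (typeclasses eauto) | cbn [head behead]].

(** * Pairing and decision trees on the natural numbers *)

(** The pairing function enumerates the diagonals [i + j = s], the diagonal
    [s] starting at the triangular number of [s]; injectivity amounts to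
    successive diagonals being disjoint. *)
Lemma triS s : (s.+1 * s.+2)./2 = (s * s.+1)./2 + s.+1.
Proof.
have -> : s.+1 * s.+2 = s * s.+1 + (s.+1).*2 by rewrite -mul2n; lia.
by rewrite halfD odd_double andbF doubleK.
Qed.

Lemma tri_le s t : s <= t -> (s * s.+1)./2 <= (t * t.+1)./2.
Proof. by move=> st; apply/half_leq/leq_mul. Qed.

Lemma cpair_inj i j i' j' : cpair i j = cpair i' j' -> i = i' /\ j = j'.
Proof.
have key a b a' b' : a + b < a' + b' -> cpair a b < cpair a' b'.
  rewrite /cpair => lt; apply: (@leq_trans (((a + b).+1 * (a + b).+2)./2)).
    by rewrite triS; lia.
  by apply: leq_trans (leq_addr _ _); apply: tri_le.
move=> E; have [lt|gt|eqs] := ltngtP (i + j) (i' + j').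
- by have := key _ _ _ _ lt; rewrite E ltnn.
- by have := key _ _ _ _ gt; rewrite E ltnn.
by move: E; rewrite /cpair eqs; lia.
Qed.

(** With [i, j <= 2 ^ d] the pair is at most [(i + j + 1) ^ 2]; the exponent
    is rounded up to the product used to combine depths, so that a single
    operation bounds both depths and exponents. *)
Lemma cpair_le i j d d' : i <= 2 ^ d -> j <= 2 ^ d' ->
  cpair i j <= 2 ^ ((d + 2) * (d' + 2)).
Proof.
move=> hi hj; have h0 : 0 < 2 ^ d by rewrite expn_gt0.
have h0' : 0 < 2 ^ d' by rewrite expn_gt0.
set x := 2 ^ d in hi h0; set y := 2 ^ d' in hj h0'.
apply: (@leq_trans ((x * 4 * y) ^ 2)).
  rewrite /cpair; apply: (@leq_trans ((i + j).+1 ^ 2)).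
    have : ((i + j) * (i + j).+1)./2 <= (i + j) * (i + j).+1.
      by lia.
    rewrite expnS expn1; nia.
  by rewrite leq_exp2r//; nia.
rewrite /x /y (_ : 4 = 2 ^ 2)// -!expnD -expnM leq_exp2l//; nia.
Qed.

Definition cfst (c : nat) : nat := xget 0 [set i | exists j, c = cpair i j].
Definition csnd (c : nat) : nat := xget 0 [set j | exists i, c = cpair i j].

Lemma cfstK i j : cfst (cpair i j) = i.
Proof.
rewrite /cfst; case: xgetP => [_ _ [k /cpair_inj[]]//|/(_ i)].
by case; exists j.
Qed.

Lemma csndK i j : csnd (cpair i j) = j.
Proof.
rewrite /csnd; case: xgetP => [_ _ [k /cpair_inj[]]//|/(_ j)].
by case; exists i.
Qed.

Lemma cfst_le c : cfst c <= c.
Proof.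
rewrite /cfst; case: xgetP => // i _ [j ->]; rewrite /cpair.
by rewrite -[leqLHS](doubleK i); apply: leq_trans (leq_addr _ _); apply: half_leq; nia.
Qed.

Lemma csnd_le c : csnd c <= c.
Proof. by rewrite /csnd; case: xgetP => // j _ [i ->]; apply: leq_addl. Qed.

(** A sample sends [v] below [n / 2], and the default neighbor 0 is below [n]
    as well because [v < n] makes [n] positive. *)
Lemma neighbor_lt n w v : memN w (structures n) -> v < n -> neighbor w v < n.
Proof.
rewrite /memN /structures set_of_codeK in_fset /= => /mapP[f _ ->] vn.
rewrite /neighbor; case: xgetP => [j _|_]; last exact: leq_ltn_trans vn.
rewrite /= /memN /graph_code set_of_codeK in_fset => /mapP[i _].
case/cpair_inj=> _ ->; apply: leq_trans (ltn_ord _) _.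
by lia.
Qed.

(** Induction with a hypothesis for each subtree; the automatic principle for
    this nested inductive type provides none. *)
Lemma ltree_ind (P : ltree -> Prop) :
  (forall a, P (GenTree.Leaf a)) ->
  (forall v ts, (forall i, i < size ts -> P (nth (GenTree.Leaf 0) ts i)) ->
     P (GenTree.Node v ts)) ->
  forall T, P T.
Proof.
move=> hL hN; fix IH 1; case=> [a|v ts]; first exact: hL.
apply: hN; elim: ts => [|t ts IHts] i.
  by move=> lt; exfalso; move: lt; rewrite ltn0.
by case: i => [_|i]; [exact: IH|exact: IHts].
Qed.

(** Grafting: sequential composition of tree computations. *)
Fixpoint bind (T : ltree) (k : nat -> ltree) : ltree :=
  match T with
  | GenTree.Leaf a => k a
  | GenTree.Node v ts => GenTree.Node v (map (fun t => bind t k) ts)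
  end.

Local Notation leaf0 := (GenTree.Leaf 0).

Lemma leaf_sub v ts i : i < size ts ->
  {subset leaves (nth leaf0 ts i) <= leaves (GenTree.Node v ts)}.
Proof.
move=> its a ha; apply/flattenP; exists (leaves (nth leaf0 ts i)) => //.
by apply: map_f; apply: mem_nth.
Qed.

Lemma depth_sub v ts i : i < size ts ->
  depth (nth leaf0 ts i) < depth (GenTree.Node v ts).
Proof.
rewrite /= ltnS; elim: ts i => [//|t ts IH] [|i] /=; first by rewrite leq_maxl.
by rewrite ltnS => /IH h; apply: leq_trans h (leq_maxr _ _).
Qed.

Lemma depth_Node v ts d :
  (forall i, i < size ts -> depth (nth leaf0 ts i) <= d) ->
  depth (GenTree.Node v ts) <= d.+1.
Proof.
rewrite /= ltnS; elim: ts => [//|t ts IH] h /=; rewrite geq_max (h 0)//=.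
by apply: IH => i; apply: (h i.+1).
Qed.

Lemma wf_bind n T k : wf_tree n T ->
  (forall a, a \in leaves T -> wf_tree n (k a)) -> wf_tree n (bind T k).
Proof.
elim/ltree_ind: T => [a _ h|v ts IH /= /and3P[-> sz /all_nthP wf] h] /=.
  by apply: h; rewrite inE.
rewrite size_map sz /=; apply/(all_nthP leaf0) => i; rewrite size_map => its.
rewrite (nth_map leaf0)//; apply: IH => //; first exact: wf.
by move=> a ha; apply: h; apply: (leaf_sub v its).
Qed.

Lemma depth_bind T k d :
  (forall a, a \in leaves T -> depth (k a) <= d) ->
  depth (bind T k) <= depth T + d.
Proof.
elim/ltree_ind: T => [a h|v ts IH h] /=; first by rewrite add0n h /= ?inE.
rewrite addSn; apply: (depth_Node v) => i; rewrite size_map => its.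
rewrite (nth_map leaf0)//; apply: leq_trans (IH _ its _) _.
  by move=> a /(leaf_sub v its); apply: h.
by rewrite leq_add2r; have := depth_sub v its.
Qed.

Lemma leaves_bind T k a : a \in leaves (bind T k) ->
  exists2 b, b \in leaves T & a \in leaves (k b).
Proof.
elim/ltree_ind: T => [b h|v ts IH] /=; first by exists b; rewrite ?inE.
case/flattenP=> _ /mapP[_ /mapP[t /(nthP leaf0)[i its <-] ->] ->] /(IH _ its)[b hb ha].
by exists b => //; apply: (leaf_sub v its).
Qed.

Section Run.
Variables (n w : nat).
Hypothesis hw : memN w (structures n).

Lemma run_Node v ts : wf_tree n (GenTree.Node v ts) ->
  [/\ neighbor w v < size ts, wf_tree n (nth leaf0 ts (neighbor w v))
    & run w (GenTree.Node v ts) = run w (nth leaf0 ts (neighbor w v))].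
Proof.
case/and3P=> vn /eqP sz /all_nthP wf.
have lt : neighbor w v < size ts by rewrite sz; apply: neighbor_lt.
by split=> //; [apply: wf|rewrite /= (nth_map leaf0)].
Qed.

Lemma run_leaf T : wf_tree n T -> run w T \in leaves T.
Proof.
elim/ltree_ind: T => [a _|v ts IH wf]; first by rewrite inE.
have [lt wf' ->] := run_Node wf.
by apply: (leaf_sub v lt); apply: IH.
Qed.

Lemma run_bind T k : wf_tree n T -> run w (bind T k) = run w (k (run w T)).
Proof.
elim/ltree_ind: T => [//|v ts IH] wf.
have [lt wf' ->] := run_Node wf; rewrite -IH//.
by rewrite /= (nth_map leaf0) ?size_map// (nth_map leaf0).
Qed.

End Run.

(** One number [d] bounds both the depth and, through [2 ^ d], the labels of the
    leaves: both requirements of the trees in T_nb come from the same cut. *)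
Definition small (n d : nat) (T : ltree) : Prop :=
  [/\ wf_tree n T, depth T <= d & forall a, a \in leaves T -> a <= 2 ^ d].

(** A monotone operation above sums and products, under which the shallow
    depths are closed. *)
Definition grow (d d' : nat) : nat := (d + 2) * (d' + 2).

Lemma small_le n d d' T : d <= d' -> small n d T -> small n d' T.
Proof.
move=> dd [wf dep lv]; split=> //; first exact: leq_trans dd.
by move=> a /lv h; apply: leq_trans h _; rewrite leq_exp2l.
Qed.

Lemma small_Leaf n d a : a <= 2 ^ d -> small n d (GenTree.Leaf a).
Proof. by move=> ad; split=> // b; rewrite inE => /eqP ->. Qed.

Lemma small_bind n d d' T k : small n d T ->
  (forall a, a <= 2 ^ d -> small n d' (k a)) -> small n (grow d d') (bind T k).
Proof.
move=> [wf dep lv] hk; split.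
- by apply: wf_bind => // a /lv /hk[].
- apply: (@leq_trans (d + d')); last by rewrite /grow; nia.
  apply: (@leq_trans (depth T + d')); last by rewrite leq_add2r.
  by apply: depth_bind => a /lv /hk[].
move=> a /leaves_bind[b /lv/hk[_ _ h] /h] ad; apply: leq_trans ad _.
by rewrite leq_exp2l// /grow; nia.
Qed.

Lemma run_small n d T w : small n d T -> memN w (structures n) ->
  run w T <= 2 ^ d.
Proof. by move=> [wf _ lv] hw; apply: lv; apply: run_leaf hw _ wf. Qed.

Definition smallN (n d c : nat) : Prop := small n d (tree_of_code c).

Lemma tree_codeK (T : ltree) : tree_of_code (choice.pickle T) = T.
Proof. by rewrite /tree_of_code choice.pickleK. Qed.

Definition tree_seq b (F : nat -> ltree) : nat :=
  choice.pickle (mkseq (fun i => choice.pickle (F i)) b).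

Lemma nth_tree_seq b F i : i < b -> tree_of_code (nthN (tree_seq b F) i) = F i.
Proof.
move=> ib; rewrite /nthN /seq_of_code choice.pickleK /= nth_mkseq//.
exact: tree_codeK.
Qed.

(** * Shallow depths and the cut *)

Lemma seq_max (s : seq nat) :
  exists a, (a \in s \/ a = 0) /\ forall b, b \in s -> b <= a.
Proof.
elim: s => [|x s [a [ha hs]]]; first by exists 0; split; [right|].
have [ax|xa] := leqP a x; [exists x|exists a]; split.
- by left; rewrite mem_head.
- move=> b; rewrite inE => /predU1P[->//|/hs ba]; exact: leq_trans ax.
- by case: ha => [h|->]; [left; rewrite inE h orbT|right].
- by move=> b; rewrite inE => /predU1P[->|/hs//]; apply: ltnW.
Qed.

(** With [s] the minimum of [t], [t'] and [log n], both depths are at most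
    [r := root n s], and [r >= 2] because [2 ^ s <= n]. Thus [grow d d'] is at
    most [r ^ 4], and [(r ^ 4) ^ (s / 4) <= r ^ s <= n]. Taking the logarithm
    of [n] into the minimum only serves to have [r >= 2]. *)
Lemma grow_root n t t' d d' :
  4 <= minn (minn t t') (trunc_log 2 n) ->
  d <= root n t -> d' <= root n t' ->
  grow d d' <= root n (half (half (minn (minn t t') (trunc_log 2 n)))).
Proof.
set s := minn _ _ => s4 hd hd'.
have sl : s <= trunc_log 2 n by apply: geq_minr.
have st : s <= t by apply: leq_trans (geq_minl _ _) (geq_minl _ _).
have st' : s <= t' by apply: leq_trans (geq_minl _ _) (geq_minr _ _).
have n0 : 0 < n by move: (leq_trans s4 sl); case: (n); rewrite ?trunc_log0.
have sn : 2 ^ s <= n.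
  by apply: leq_trans (@trunc_logP 2 n isT n0); rewrite leq_exp2l.
have s0 : 0 < s by lia.
have r2 : 1 < root n s.
  by apply: leq_root (sn); apply: leq_trans sn; rewrite -[leqLHS](expn1 2) leq_exp2l.
have {}hd : d <= root n s by apply: (leq_trans hd); apply: root_le.
have {}hd' : d' <= root n s by apply: (leq_trans hd'); apply: root_le.
set r := root n s in r2 hd hd'.
apply: (@leq_trans (r ^ 4)).
  rewrite /grow (_ : r ^ 4 = (r * r) * (r * r)); last by rewrite !expnS; lia.
  by apply: leq_mul; nia.
have rs : r ^ s <= n by apply: root_exp.
have h4 : 4 <= s by [].
have q0 : 0 < s./2./2 by lia.
apply: leq_root; last rewrite -expnM; apply: leq_trans (_ : r ^ s <= n) => //;
  rewrite leq_exp2l//; lia.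
Qed.

Section Cut.
Variable S : setting.
Implicit Types (x y z a b d s t T : S) (w : Omega S).
Local Notation n := (idx S).

Lemma leM_trans x y z : rel2 leN x y -> rel2 leN y z -> rel2 leN x z.
Proof. by move: x y z; transfer => x y z; apply: leq_trans. Qed.

Lemma ltM_le x y : rel2 ltN x y -> rel2 leN x y.
Proof. by move: x y; transfer => x y; apply: ltnW. Qed.

Lemma ltM_succ x y : rel2 ltN x (app2 addn y (std S 1)) <-> rel2 leN x y.
Proof. by move: x y; transfer => x y; rewrite /ltN addn1 ltnS. Qed.

Definition shallow d : Prop :=
  exists2 t, nonstd t & rel2 leN d (app2 root n t).

Lemma shallow_le d d' : rel2 leN d d' -> shallow d' -> shallow d.
Proof. by move=> dd [t ht d't]; exists t => //; apply: leM_trans d't. Qed.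

Lemma shallow0 : shallow (std S 0).
Proof.
exists n; first exact: idx_nonstd.
by move: n; transfer => m; apply: leq0n.
Qed.

Lemma shallow_grow d d' : shallow d -> shallow d' -> shallow (app2 grow d d').
Proof.
move=> [t ht dt] [t' ht' dt']; have HM := @model_true S.
pose s := app2 minn (app2 minn t t') (app1 (trunc_log 2) n).
have hs : nonstd s.
  apply: (nonstd_min HM); first exact: (nonstd_min HM).
  by apply: (nonstd_log HM) => //; apply: idx_nonstd.
exists (app1 half (app1 half s)); first by do 2 apply: (nonstd_half HM).
have : rel2 leN (std S 4) s by apply: (nonstd_ge HM).
move: dt dt'; rewrite /s; move: n t t' d d' {ht ht' hs s}; transfer.
by move=> n t t' d d' dt dt' hs; apply: grow_root.
Qed.

Lemma inMnP x :
  inMn x <-> exists2 d, shallow d & rel2 leN x (app1 (expn 2) d).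
Proof.
split=> [[t ht xt]|[d [t ht dt] xd]].
  exists (app2 root n t).
    by exists t => //; move: n t {ht xt}; transfer => m t; apply: leqnn.
  by move: x n t xt {ht}; transfer.
exists t => //; move: x d n t dt xd {ht}; transfer => x d n t dt xd.
by apply: leq_trans xd _; rewrite leq_exp2l.
Qed.

Lemma inMn_exp d : shallow d -> inMn (app1 (expn 2) d).
Proof.
by move=> hd; apply/inMnP; exists d => //; move: d {hd}; transfer => d; apply: leqnn.
Qed.

Lemma inMn_le x y : rel2 leN x y -> inMn y -> inMn x.
Proof.
by move=> xy /inMnP[d hd yd]; apply/inMnP; exists d => //; apply: leM_trans yd.
Qed.

Lemma inMn_succ x : inMn x -> inMn (app2 addn x (std S 1)).
Proof. by move=> hx; apply: inMn_add => //; apply: inMn_std. Qed.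

Lemma cpairM_inj x y x' y' :
  app2 cpair x y = app2 cpair x' y' -> x = x' /\ y = y'.
Proof. by move: x y x' y'; transfer => x y x' y'; apply: cpair_inj. Qed.

(** The depth and the leaves of a tree in T_nb can be bounded by a single
    shallow number: a tree has a largest leaf, so its leaves, which lie in the
    cut one by one, lie below one element of the cut. *)
Lemma inTnbP T : inTnb T <-> exists2 d, shallow d & rel3 smallN n d T.
Proof.
split=> [[wf lv [t ht dep]]|[d hd hT]].
  have [a [ha leaf_a]] : exists a, (rel2 leafN a T \/ a = std S 0) /\
      forall b, rel2 leafN b T -> rel2 leN b a.
    by move: T {wf lv dep}; transfer => T; apply: seq_max.
  have /inMnP[d hd ad] : inMn a.
    by case: ha => [/lv//|->]; apply: inMn_std.
  exists (app2 grow (app2 root n t) d).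
    apply: shallow_grow => //; exists t => //.
    by move: n t {ht dep wf}; transfer => m t; apply: leqnn.
  move: n t T d a wf dep leaf_a ad {lv ht ha hd}; transfer.
  move=> n t T d a wf dep leaf_a ad; split=> //.
    by apply: leq_trans dep _; rewrite /grow; nia.
  move=> b /leaf_a ba; apply: (leq_trans ba); apply: (leq_trans ad).
  by rewrite leq_exp2l// /grow; nia.
split.
- by move: n d T hT {hd}; transfer => m d T [].
- move=> a ha; apply: inMn_le (inMn_exp hd).
  by move: n d T a hT ha {hd}; transfer => m d T a [_ _]; apply.
have [t ht dt] := hd; exists t => //; apply: leM_trans dt.
by move: n d T hT {hd}; transfer => m d T [].
Qed.

End Cut.

(** * Uniform families of tree functions *)

Lemma family_bind n d d' b s s' :
  (forall i, i < b -> smallN n d (nthN s i)) ->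
  (forall a, a <= 2 ^ d -> smallN n d' (nthN s' a)) ->
  exists s'', forall i, i < b -> smallN n (grow d d') (nthN s'' i) /\
    forall w, memN w (structures n) ->
      runN (nthN s'' i) w = runN (nthN s' (runN (nthN s i) w)) w.
Proof.
move=> hs hs'; exists (tree_seq b (fun i => bind (tree_of_code (nthN s i))
  (fun a => tree_of_code (nthN s' a)))) => i ib.
rewrite /smallN /runN nth_tree_seq//; split.
  by apply: small_bind; [apply: hs|apply: hs'].
by move=> w hw; apply: (run_bind hw); have [] := hs i ib.
Qed.

Lemma family_pair n d d' b s s' :
  (forall i, i < b -> smallN n d (nthN s i)) ->
  (forall i, i < b -> smallN n d' (nthN s' i)) ->
  exists s'', forall i, i < b ->
    smallN n (grow d (grow d' (grow d d'))) (nthN s'' i) /\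
    forall w, memN w (structures n) ->
      runN (nthN s'' i) w = cpair (runN (nthN s i) w) (runN (nthN s' i) w).
Proof.
move=> hs hs'; exists (tree_seq b (fun i => bind (tree_of_code (nthN s i))
  (fun a => bind (tree_of_code (nthN s' i))
    (fun a' => GenTree.Leaf (cpair a a'))))) => i ib.
rewrite /smallN /runN nth_tree_seq//; split.
  apply: small_bind; first exact: hs.
  move=> a ha; apply: small_bind; first exact: hs'.
  by move=> a' ha'; apply/small_Leaf/cpair_le.
move=> w hw; rewrite (run_bind hw) ?(run_bind hw)//.
  by have [] := hs' i ib.
by have [] := hs i ib.
Qed.

Definition computes (n d T c : nat) : Prop :=
  smallN n d T /\
  forall w, memN w (structures n) -> memN (cpair w (runN T w)) c.

(** The least common depth of trees computing the functions coded by the first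
    entries of [g] is attained: some entry needs a tree of that depth. This is
    what turns shallowness of each single tree into shallowness of the common
    bound. *)
Lemma family_of_graphs n b r g :
  (forall i, i < b -> i < r -> exists d T, computes n d T (nthN g i)) ->
  exists d s, (d = 0 \/ exists i, [/\ i < b, i < r &
      forall d' T', computes n d' T' (nthN g i) -> d <= d']) /\
    forall i, i < b -> (i < r -> computes n d (nthN s i) (nthN g i)) /\
      (~ i < r -> nthN s i = leaf_code 0).
Proof.
move=> h; suff [d [F [hd hF]]] : exists d F, (d = 0 \/ exists i,
    [/\ i < b, i < r & forall d' T', computes n d' T' (nthN g i) -> d <= d']) /\
    forall i, i < b -> i < r -> computes n d (F i) (nthN g i).
  exists d, (choice.pickle
    (mkseq (fun i => if i < r then F i else leaf_code 0) b)); split=> // i ib.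
  rewrite {1 3}/nthN /seq_of_code choice.pickleK /= nth_mkseq//.
  by split=> [ir|/negP/negPf -> //]; rewrite ir; apply: hF.
elim: b h => [|b IH] h; first by exists 0, id; split; [left|].
have [i ib ir|d [F [hd hF]]] := IH; first by apply: h => //; apply: ltnW.
have up d1 T1 d2 c : d1 <= d2 -> computes n d1 T1 c -> computes n d2 T1 c.
  by move=> le [sm ru]; split=> //; apply: small_le sm.
have [br|rb] := ltnP b r; last first.
  exists d, F; split; last first.
    move=> i; rewrite ltnS leq_eqVlt => /predU1P[->|]; last exact: hF.
    by rewrite ltnNge rb.
  by case: hd => [|[i [ib ir hi]]]; [left|right; exists i; split=> //; apply: ltnW].
have /cid[d0 [d0P d0min]] : exists d0, (exists T, computes n d0 T (nthN g b)) /\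
    forall d' T', computes n d' T' (nthN g b) -> d0 <= d'.
  have [d' [T' hT']] := h b (leqnn _) br.
  pose P d := `[< exists T, computes n d T (nthN g b) >].
  have eP : exists d, P d by exists d'; apply/asboolP; exists T'.
  exists (ex_minn eP); case: ex_minnP => m /asboolP mP mmin; split=> // d1 T1 h1.
  by apply: mmin; apply/asboolP; exists T1.
have [T0 T0P] := d0P.
exists (maxn d d0), (fun i => if i == b then T0 else F i); split.
  have [dd|dd] := leqP d0 d.
    by case: hd => [|[i [ib ir hi]]]; [left|right; exists i; split=> //; apply: ltnW].
  by right; exists b; split.
move=> i; rewrite ltnS leq_eqVlt => /predU1P[->|ib ir].
  by rewrite eqxx => _; apply: up T0P; apply: leq_maxr.
by rewrite ltn_eqF//; apply: up (hF _ ib ir); apply: leq_maxl.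
Qed.

Section Uniform.
Variable S : setting.
Implicit Types x y z a b d s t T i : S.
Local Notation n := (idx S).

(** The depth bound [d] is the same for all arguments below [b]; trees of
    unboundedly many different depths, each of them shallow, would not do for
    composition. *)
Definition uniform (h : Omega S -> S -> S) : Prop :=
  forall b, inMn b -> exists s d, [/\ shallow d,
    forall i, rel2 ltN i b -> rel3 smallN n d (app2 nthN s i)
  & forall w i, rel2 ltN i b -> h w i = runM (app2 nthN s i) (sval w)].

Lemma sampleP (w : Omega S) : rel2 memN (sval w) (app1 structures n).
Proof. exact: svalP w. Qed.

Lemma runM_le d T (w : Omega S) : rel3 smallN n d T ->
  rel2 leN (runM T (sval w)) (app1 (expn 2) d).
Proof.
have := sampleP w; rewrite /runM; move: n d T (sval w); transfer.
by move=> m d T v hv hT; apply: run_small hT hv.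
Qed.

Lemma uniform_Fnb h a : uniform h -> inMn a ->
  exists f : Fnb S, forall w, f w = h w a.
Proof.
move=> hh /inMn_succ/hh[s [d [hd hs E]]].
have lta : rel2 ltN a (app2 addn a (std S 1)).
  by apply/ltM_succ; move: a {hs E}; transfer => a; apply: leqnn.
have hT : exists2 T, inTnb T & forall w, h w a = runM T (sval w).
  exists (app2 nthN s a); first by apply/inTnbP; exists d => //; apply: hs.
  by move=> w; rewrite E.
by exists (exist _ (fun w => h w a) hT).
Qed.

Lemma Fnb_Mn (f : Fnb S) w : inMn (f w).
Proof.
have [T /inTnbP[d hd hT] E] := svalP f; rewrite /rvar E.
exact: inMn_le (runM_le w hT) (inMn_exp hd).
Qed.

Lemma uniform_Mn h w a : uniform h -> inMn a -> inMn (h w a).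
Proof. by move=> hh /(uniform_Fnb hh)[f <-]; apply: Fnb_Mn. Qed.

Lemma uniform_cst (f : Fnb S) : uniform (fun w _ => f w).
Proof.
move=> b _; have [T /inTnbP[d hd hT] E] := svalP f.
have [s hs] : exists s, forall i, rel2 ltN i b -> app2 nthN s i = T.
  move: b T {hT E}; transfer => b T.
  exists (choice.pickle (mkseq (fun=> T) b)) => i ib.
  by rewrite /nthN /seq_of_code choice.pickleK /= nth_mkseq.
by exists s, d; split=> // [i /hs ->|w i /hs ->]; [exact: hT|exact: E].
Qed.

Lemma uniform_id : uniform (fun _ a => a).
Proof.
move=> b /inMnP[d hd bd].
have [s hs] : exists s, forall i, rel2 ltN i b -> app2 nthN s i = app1 leaf_code i.
  move: b {bd}; transfer => b; exists (choice.pickle (mkseq leaf_code b)) => i ib.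
  by rewrite /nthN /seq_of_code choice.pickleK /= nth_mkseq.
exists s, d; split=> // [i ib|w i ib].
  rewrite hs//; move: ib bd {hs hd}; move: n d i b; transfer => m d i b ib bd.
  rewrite /smallN /leaf_code tree_codeK; apply/small_Leaf/(leq_trans _ bd).
  exact: ltnW.
by rewrite hs// /runM; apply: (leaf_run (@model_true S)).
Qed.

(** The values of [f] below [b] have a maximum, which lies in the cut because
    it is itself a value of [f]. *)
Lemma uniform_map f : (forall x, inMn x -> inMn (app1 f x)) ->
  uniform (fun _ a => app1 f a).
Proof.
move=> hf b hb.
have [c [hc fc]] : exists c,
    (c = std S 0 \/ exists i, rel2 ltN i b /\ c = app1 f i) /\
    forall i, rel2 ltN i b -> rel2 leN (app1 f i) c.
  move: b {hb}; transfer => b; have [c [hc h]] := seq_max (mkseq f b).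
  exists c; split; last first.
    by move=> i ib; apply: h; apply/mapP; exists i; rewrite ?mem_iota.
  case: hc => [/mapP[i hi ->]|]; [right|by left].
  by exists i; split=> //; move: hi; rewrite mem_iota.
have /inMnP[d hd cd] : inMn c.
  case: hc => [->|[i [ib ->]]]; first exact: inMn_std.
  by apply/hf/(inMn_le (ltM_le ib)).
have [s hs] : exists s, forall i, rel2 ltN i b ->
    app2 nthN s i = app1 leaf_code (app1 f i).
  move: b {hb hc fc}; transfer => b.
  exists (choice.pickle (mkseq (leaf_code \o f) b)) => i ib.
  by rewrite /nthN /seq_of_code choice.pickleK /= nth_mkseq.
exists s, d; split=> // [i ib|w i ib].
  rewrite hs//; have {ib}ic := leM_trans (fc i ib) cd.
  move: ic {hs hd hc fc cd}; move: n d i; transfer => m d i ic.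
  by rewrite /smallN /leaf_code tree_codeK; apply: small_Leaf.
by rewrite hs// /runM; apply: (leaf_run (@model_true S)).
Qed.

Lemma uniform_ext h h' : (forall w a, inMn a -> h w a = h' w a) ->
  uniform h -> uniform h'.
Proof.
move=> E hh b hb; have [s [d [hd hs Es]]] := hh b hb; exists s, d; split=> //.
by move=> w i ib; rewrite -Es// E//; apply: inMn_le (ltM_le ib) hb.
Qed.

(** The values of [h] at arguments below [b] are at most [2 ^ d] with [d]
    shallow, which bounds the arguments at which [k] is needed. *)
Lemma uniform_bind h k : uniform h -> uniform k ->
  uniform (fun w a => k w (h w a)).
Proof.
move=> hh hk b /hh[s [d [hd hs Es]]].
have [s' [d' [hd' hs' Es']]] := hk _ (inMn_succ (inMn_exp hd)).
have {}hs' a : rel2 leN a (app1 (expn 2) d) -> rel3 smallN n d' (app2 nthN s' a).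
  by move/ltM_succ; apply: hs'.
have [s'' hs''] : exists s'', forall i, rel2 ltN i b ->
    rel3 smallN n (app2 grow d d') (app2 nthN s'' i) /\
    forall w, rel2 memN w (app1 structures n) ->
     app2 runN (app2 nthN s'' i) w =
     app2 runN (app2 nthN s' (app2 runN (app2 nthN s i) w)) w.
  move: hs hs' {Es Es' hd hd'}; move: n d d' b s s'; transfer.
  exact: family_bind.
exists s'', (app2 grow d d'); split.
- exact: shallow_grow.
- by move=> i /hs''[].
move=> w i ib; rewrite Es// Es'; last by apply/ltM_succ/runM_le/hs.
by have [_ h''] := hs'' i ib; rewrite /runM h''//; apply: sampleP.
Qed.

Lemma uniform_pair h k : uniform h -> uniform k ->
  uniform (fun w a => app2 cpair (h w a) (k w a)).
Proof.
move=> hh hk b hb; have [s [d [hd hs Es]]] := hh b hb.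
have [s' [d' [hd' hs' Es']]] := hk b hb.
have [s'' hs''] : exists s'', forall i, rel2 ltN i b ->
    rel3 smallN n (app2 grow d (app2 grow d' (app2 grow d d'))) (app2 nthN s'' i) /\
    forall w, rel2 memN w (app1 structures n) ->
     app2 runN (app2 nthN s'' i) w =
     app2 cpair (app2 runN (app2 nthN s i) w) (app2 runN (app2 nthN s' i) w).
  move: hs hs' {Es Es' hd hd' hb}; move: n d d' b s s'; transfer.
  exact: family_pair.
exists s'', (app2 grow d (app2 grow d' (app2 grow d d'))); split.
- by do 3 apply: shallow_grow => //.
- by move=> i /hs''[].
move=> w i ib; rewrite Es// Es'//.
by have [_ h''] := hs'' i ib; rewrite /runM h''//; apply: sampleP.
Qed.

(** By injectivity of pairing, a tree whose graph is contained in the code of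
    a function computes this function. *)
Lemma codes_fun_computes c (f : Fnb S) T : codes_fun c f ->
  (forall w : Omega S, rel2 memN (app2 cpair (sval w) (runM T (sval w))) c) <->
  forall w, f w = runM T (sval w).
Proof.
move=> hc; split=> h w; last by rewrite -h; apply/hc; exists w.
by have /hc[w' /cpairM_inj[/eq_sig_hprop -> //]] := h w.
Qed.

(** The defining condition of a unary member of G_nb speaks of arguments in
    F_nb; constant functions suffice to read off all values. The family is
    assembled from the trees of the components by [family_of_graphs]. *)
Lemma uniform_unary (F : rfun S 1) : inGnb F ->
  uniform (fun w a => rapply F w [tuple a]).
Proof.
move=> [g [gamma [hr hg E]]] b hb; set r := app1 lenN g in hr E.
have {}hg i : rel2 ltN i r -> codes_fun (app2 nthN g i) (gamma i) by exact: hg.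
clearbody r.
have hF w a : inMn a -> rapply F w [tuple a] =
    if pselect (rel2 ltN a r) then gamma a w else std S 0.
  by move=> ha; have := E (cst ha) w.
have sw w : rel2 memN w (app1 structures n) -> exists w' : Omega S, w = sval w'.
  by move=> hw; exists (exist (fun w => rel2 memN w (Mn_code S)) w hw).
have comp i : rel2 ltN i r -> exists d T, shallow d /\
    (rel3 smallN n d T /\ forall w, rel2 memN w (app1 structures n) ->
       rel2 memN (app2 cpair w (app2 runN T w)) (app2 nthN g i)).
  move=> ir; have [T /inTnbP[d hd hT] ET] := svalP (gamma i).
  exists d, T; split=> //; split=> // _ /sw[w ->].
  exact: (proj2 (codes_fun_computes T (hg i ir)) ET).
have [d [s [hd hs]]] : exists d s, (d = std S 0 \/ exists i,
     rel2 ltN i b /\ rel2 ltN i r /\ forall d' T',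
      (rel3 smallN n d' T' /\ forall w, rel2 memN w (app1 structures n) ->
       rel2 memN (app2 cpair w (app2 runN T' w)) (app2 nthN g i)) ->
      rel2 leN d d') /\
    forall i, rel2 ltN i b ->
     (rel2 ltN i r -> rel3 smallN n d (app2 nthN s i) /\
      forall w, rel2 memN w (app1 structures n) ->
       rel2 memN (app2 cpair w (app2 runN (app2 nthN s i) w)) (app2 nthN g i)) /\
     (~ rel2 ltN i r -> app2 nthN s i = app1 leaf_code (std S 0)).
  have : forall i, rel2 ltN i b -> rel2 ltN i r -> exists d T,
    rel3 smallN n d T /\ forall w, rel2 memN w (app1 structures n) ->
       rel2 memN (app2 cpair w (app2 runN T w)) (app2 nthN g i).
    by move=> i _ /comp[d [T [_ h]]]; exists d, T.
  move: n b r g {hr hg E hF sw comp hb}; transfer => m b r g h.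
  have [d [s [hd hs]]] := family_of_graphs h; exists d, s; split=> //.
  by case: hd => [|[i [ib ir hi]]]; [left|right; exists i].
have {}hd : shallow d.
  case: hd => [->|[i [ib [ir hi]]]]; first exact: shallow0.
  by have [d' [T [hd' /hi dd]]] := comp i ir; apply: shallow_le dd hd'.
exists s, d; split=> // [i ib|w i ib].
  have [h1 h2] := hs i ib.
  have [ir|nr] := pselect (rel2 ltN i r); first by have [] := h1 ir.
  rewrite h2//.
  move: n d {hd hs h1 h2 hF E sw comp}; transfer => m d.
  by rewrite /smallN /leaf_code tree_codeK; apply: small_Leaf.
rewrite hF; last exact: inMn_le (ltM_le ib) hb.
have [h1 h2] := hs i ib; case: pselect => [ir|nr]; last first.
  rewrite h2//.
  exact: (leaf_run (@model_true S)).
have [_ hw] := h1 ir.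
by apply: (proj1 (codes_fun_computes _ (hg i ir))) => w'; apply/hw/sampleP.
Qed.

End Uniform.

(** * Terms *)

(** Undoes [pair_last], turning a function of several arguments into one with
    an argument fewer, applied to the paired tuple. *)
Definition unpair_last k (u : k.+1.-tuple nat) : k.+2.-tuple nat :=
  [tuple if unlift ord_max j is Some i
         then if i == ord_max then cfst (tnth u ord_max) else tnth u i
         else csnd (tnth u ord_max) | j < k.+2].

Section Terms.
Variable S : setting.
Implicit Types x y z : S.

Lemma funI_le k (f g : k.-tuple nat -> nat) (v : k.-tuple S) :
  (forall u, f u <= g u) -> rel2 leN (funI f v) (funI g v).
Proof. by move=> fg; apply/(relI_comp2 leN f g v); apply: relI_true. Qed.

Lemma tnth_unpair_last k (u : k.+1.-tuple S) (j : 'I_k.+2) :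
  funI (fun t => tnth (unpair_last t) j) u =
  if unlift ord_max j is Some i
  then if i == ord_max then app1 cfst (tnth u ord_max) else tnth u i
  else app1 csnd (tnth u ord_max).
Proof.
have -> : (fun t => tnth (unpair_last t) j) = (fun t => if unlift ord_max j is Some i
         then if i == ord_max then cfst (tnth t ord_max) else tnth t i
         else csnd (tnth t ord_max)) by apply/funext => t; rewrite tnth_mktuple.
case: unlift => [i|]; last by rewrite funI_comp1 funI_proj.
by case: eqP => _; rewrite ?funI_comp1 funI_proj.
Qed.

Lemma funI_unpair_last k (f : k.+2.-tuple nat -> nat) (u : k.+1.-tuple S) :
  funI (fun t => f (unpair_last t)) u =
  funI f [tuple if unlift ord_max j is Some i
    then if i == ord_max then app1 cfst (tnth u ord_max) else tnth u i
    else app1 csnd (tnth u ord_max) | j < k.+2].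
Proof.
transitivity (funI f [tuple funI (fun t => tnth (unpair_last t) j) u | j < k.+2]).
  by rewrite -funI_comp; congr funI; apply/funext => t; rewrite tuple_tnth.
by congr funI; apply: eq_mktuple => j; apply: tnth_unpair_last.
Qed.

Lemma unpair_pair_last k (v : k.+2.-tuple S) :
  [tuple if unlift ord_max j is Some i
    then if i == ord_max then app1 cfst (tnth (pair_last v) ord_max)
         else tnth (pair_last v) i
    else app1 csnd (tnth (pair_last v) ord_max) | j < k.+2] = v.
Proof.
apply: eq_from_tnth => j; rewrite tnth_mktuple.
have fK : forall x y, app1 cfst (app2 cpair x y) = x.
  by transfer => x y; apply: cfstK.
have sK : forall x y, app1 csnd (app2 cpair x y) = y.
  by transfer => x y; apply: csndK.
case: unliftP => [i|] ->; rewrite !tnth_mktuple eqxx ?fK ?sK //.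
by case: eqP => [->|].
Qed.

Lemma uniform_pair_last k (h : 'I_k.+2 -> Omega S -> S -> S) (i : 'I_k.+1) :
  (forall j, uniform (h j)) ->
  uniform (fun w x => tnth (pair_last [tuple h j w x | j < k.+2]) i).
Proof.
move=> hh; have [->|im] := eqVneq i ord_max.
  apply: uniform_ext (uniform_pair (hh (lift ord_max ord_max)) (hh ord_max)).
  by move=> w x _; rewrite !tnth_mktuple eqxx.
apply: uniform_ext (hh (lift ord_max i)).
by move=> w x _; rewrite !tnth_mktuple (negPf im).
Qed.

Lemma inMn_unpair k (u : k.+1.-tuple S) (j : 'I_k.+2) :
  (forall i, inMn (tnth u i)) ->
  inMn (funI (fun t => tnth (unpair_last t) j) u).
Proof.
move=> hu; rewrite tnth_unpair_last.
have le1 : forall x, rel2 leN (app1 cfst x) x by transfer; apply: cfst_le.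
have le2 : forall x, rel2 leN (app1 csnd x) x by transfer; apply: csnd_le.
case: unlift => [i|]; last exact: inMn_le (le2 _) (hu _).
by case: eqP => _ //; apply: inMn_le (le1 _) (hu _).
Qed.

Lemma app1_tuple (f : 1.-tuple nat -> nat) (x : S) :
  app1 (fun y : nat => f [tuple y]) x = funI f [tuple x].
Proof.
congr funI; apply/funext => t; congr f; apply: eq_from_tnth => i.
by rewrite (ord1 i) [LHS](tnth_nth 0) /=; congr tnth; apply: val_inj.
Qed.

(** A symbol of arity [k + 2] is the composite of one of arity [k + 1] with the
    pairing of two arguments, as in the definition of G_nb; unary symbols are
    [uniform_map] and the arity 0 is constant. *)
Lemma uniform_fun k (f : k.-tuple nat -> nat) (h : 'I_k -> Omega S -> S -> S) :
  (forall v : k.-tuple S, (forall i, inMn (tnth v i)) -> inMn (funI f v)) ->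
  (forall i, uniform (h i)) ->
  uniform (fun w x => funI f [tuple h i w x | i < k]).
Proof.
case: k f h => [|k] f h hf hh.
  have hc : inMn (funI f ([tuple] : 0.-tuple S)) by apply: hf => -[].
  apply: uniform_ext (uniform_cst (cst hc)).
  by move=> w x _; rewrite [X in _ = funI f X]tuple0.
elim: k f h hf hh => [|k IH] f h hf hh.
  have hf' x : inMn x -> inMn (app1 (fun y : nat => f [tuple y]) x).
    by move=> hx; rewrite app1_tuple; apply: hf => i; rewrite (ord1 i).
  apply: uniform_ext (uniform_bind (hh ord0) (uniform_map hf')).
  move=> w x _; rewrite app1_tuple; congr funI; apply: eq_from_tnth => i.
  by rewrite tnth_mktuple (ord1 i).
have hf' (u : k.+1.-tuple S) : (forall i, inMn (tnth u i)) ->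
    inMn (funI (fun t => f (unpair_last t)) u).
  move=> hu; rewrite funI_unpair_last; apply: hf => j.
  by rewrite tnth_mktuple -tnth_unpair_last; apply: inMn_unpair.
have := IH _ _ hf' (fun i => uniform_pair_last i hh).
apply: uniform_ext => w x _.
by rewrite funI_unpair_last tuple_tnth unpair_pair_last.
Qed.

(** Same reduction of the arity, now by definition of G_nb. The defining
    equation is used at the constant functions with the values of the [h i] at
    the given sample. *)
Lemma uniform_Gnb k (F : rfun S k.+1) (h : 'I_k.+1 -> Omega S -> S -> S) :
  inGnb F -> (forall i, uniform (h i)) ->
  uniform (fun w x => rapply F w [tuple h i w x | i < k.+1]).
Proof.
elim: k F h => [|k IH] F h hF hh.
  apply: uniform_ext (uniform_bind (hh ord0) (uniform_unary hF)) => w x _.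
  by congr rapply; apply: eq_from_tnth => i; rewrite tnth_mktuple (ord1 i).
have [F' hF' E] := hF.
have := IH _ _ hF' (fun i => uniform_pair_last i hh).
apply: uniform_ext => w x hx; rewrite tuple_tnth.
have := E (fun i => cst (uniform_Mn w (hh i) hx)) w.
by rewrite /at_sample => ->.
Qed.

(** The value of a term at a sample when all its number variables take the
    value [x]. The induction over formulas passes through arbitrary contexts,
    but only the formulas with one number variable matter in the end, and for
    those a single value is enough. *)
Fixpoint peval s k (U : senv S s) (t : nterm S s k) (w : Omega S) (x : S) : S :=
  match t with
  | NVar _ => x
  | NPar f => f w
  | NFun a f ts => funI (sval f) [tuple peval U (ts i) w x | i < a]
  | NApp a X ts => rapply (evals U X) w [tuple peval U (ts i) w x | i < a.+1]
  end.

Lemma uniform_peval s k (U : senv S s) (t : nterm S s k) : uniform (peval U t).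
Proof.
elim: t => [i|f|a f ts IH|a X ts IH] /=.
- exact: uniform_id.
- exact: uniform_cst.
- by apply: uniform_fun IH; apply: (svalP f).
- by apply: uniform_Gnb IH; case: X => [v|F]; apply: svalP.
Qed.

Section Subst.
Variables (s s' : seq nat) (rho : sren s s').
Variables (U : senv S s) (U' : senv S s').
Hypothesis rhoU : forall a (v : svar s a), U' (rho v) = U v.

Lemma evals_subst a (X : sterm S s a) : evals U' (ssubst rho X) = evals U X.
Proof. by case: X => //= v; rewrite rhoU. Qed.

Lemma evaln_subst k k' (u : k'.-tuple (Fnb S)) (t0 : nterm S s' k')
    (t : nterm S s k) (w : Omega S) :
  evaln U' u (nsubst rho (fun=> t0) t) w = peval U t w (evaln U' u t0 w).
Proof.
elim: t => [i|f|a f ts IH|a X ts IH] //=.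
  by congr funI; apply: eq_mktuple => i.
by rewrite evals_subst; congr rapply; apply: eq_mktuple => i.
Qed.

End Subst.
End Terms.

(** * Completeness of the Boolean algebra *)

Lemma card_structures n : 1 < n -> 0 < cardN (structures n).
Proof.
move=> n1; have n2 : 0 < n./2 by lia.
rewrite /cardN /structures set_of_codeK cardfs_gt0; apply/fset0Pn.
exists (graph_code [ffun=> Ordinal n2 : 'I_(n./2)] : nat).
by rewrite in_fset /=; apply/mapP; eexists; [apply: mem_enum|].
Qed.

(** The ratio of [s] to [c] is at least [j / k]. *)
Definition density_ge k j s c : Prop := j * cardN c <= k * cardN s.

Lemma ratio_ltE a c k : 0 < k -> 0 < cardN c ->
  ratio_lt a c k <-> cardN a * k < cardN c.
Proof.
move=> k0 c0; rewrite /ratio_lt ltr_pdivrMr ?ltr0n// mulrC ltr_pdivlMr ?ltr0n//.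
by rewrite -natrM ltr_nat.
Qed.

Lemma density_union k j s t x c : {subset set_of_code s <= set_of_code x} ->
  0 < k -> 0 < cardN c -> density_ge k j s c -> ~ ratio_lt (diffN t x) c k ->
  density_ge k j.+1 (unionN t s) c.
Proof.
move=> sx k0 c0 ds; rewrite ratio_ltE// => /negP; rewrite -leqNgt => tx.
suff : cardN (diffN t x) + cardN s <= cardN (unionN t s).
  by move: ds; rewrite /density_ge; nia.
rewrite /cardN /diffN /unionN !set_of_codeK -cardfsUI.
rewrite (_ : (_ `&` _)%fset = fset0) ?cardfs0 ?addn0.
  apply/fsubset_leq_card/fsetSU/fsubsetP => y.
  by rewrite in_fsetD => /andP[].
apply/fsetP => y; rewrite in_fset0 in_fsetI in_fsetD.
by apply/negP => /andP[/andP[/negP nx _] /sx].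
Qed.

Lemma ratio_diff k j s x c : {subset set_of_code s <= set_of_code x} ->
  0 < k -> 0 < cardN c -> density_ge k j s c -> ~ density_ge k j.+1 x c ->
  ratio_lt (diffN x s) c k.
Proof.
move=> sx k0 c0; rewrite ratio_ltE// /density_ge => ds /negP; rewrite -ltnNge => dx.
have : cardN (diffN x s) + cardN s = cardN x.
  rewrite /cardN /diffN set_of_codeK cardfsD.
  have -> : (set_of_code x `&` set_of_code s)%fset = set_of_code s.
    by apply/fsetIidPr/fsubsetP.
  by rewrite subnK//; apply/fsubset_leq_card/fsubsetP.
by nia.
Qed.

(** The form in which finiteness is needed to check finite satisfiability of a
    type enumerated by the natural numbers. *)
Lemma finite_image_bounded (T : Type) (q : nat -> T) (F : set T) :
  finite_set F -> F `<=` range q ->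
  exists K, forall r, F r -> exists2 k, k < K & r = q k.
Proof.
move=> [m /card_set_bijP[f [fm finj _]]] Fq.
have /choice[g hg] : forall i, exists k, forall r, F r -> f r = i -> r = q k.
  move=> i; have [[r [Fr ri]]|nr] := EM (exists r, F r /\ f r = i).
    have [k _ qk] := Fq r Fr; exists k => r' Fr' r'i; rewrite qk.
    by apply: finj; rewrite ?inE// r'i ri.
  by exists 0 => r Fr ri; case: nr; exists r.
exists (\max_(i < m) g i).+1 => r Fr; exists (g (f r)); last exact: hg.
by have fr : f r < m := fm r Fr; rewrite ltnS (leq_bigmax (Ordinal fr)).
Qed.

Section Completeness.
Variable S : setting.
Local Notation Om := (Mn_code S).
Local Open Scope quotient_scope.

Lemma le_piP (A B : event S) :
  (\pi_(balg S) A <= \pi_(balg S) B :> balg S)%O <-> infinitesimal (A `\` B).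
Proof.
rewrite leEmeet [(_ `&` _)%O]balg_meetE.
have -> : A `\` B = eventI A B `+` A.
  apply/seteqP; split=> w /=; first by move=> [Aw nB]; right; split=> // -[].
  by move=> [[[]]|[Aw n]] //; split=> // Bw; apply: n.
by split=> [/eqP /pi_eventP|/pi_eventP ->].
Qed.

Lemma subset_codes s t (A B : set (Omega S)) : codes_event s A -> codes_event t B ->
  A `<=` B -> forall x, rel2 memN x s -> rel2 memN x t.
Proof. by move=> hs ht AB x /hs[w Aw <-]; apply/ht; exists w => //; apply: AB. Qed.

Lemma card_samples_gt0 : rel1 (fun c => 0 < cardN c) Om.
Proof.
have : rel2 leN (std S 2) (idx S) := nonstd_ge (@model_true S) 2 (@idx_nonstd S).
by rewrite /Mn_code; move: (idx S); transfer => n; apply: card_structures.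
Qed.

Variable A : set (balg S).

(** This set of events stands for the finite joins of elements of [A]: it
    contains their events, is closed under union, and has the same upper
    bounds. *)
Definition below : set (event S) :=
  [set E | forall u, ubound A u -> (\pi_(balg S) E <= u)%O].

Lemma below0 : below (event0 S).
Proof. by move=> u _; apply: balg_le0x. Qed.

Lemma belowU E F : below E -> below F -> below (eventU E F).
Proof.
move=> hE hF u hu.
have -> : \pi_(balg S) (eventU E F) = (\pi_(balg S) E `|` \pi_(balg S) F)%O.
  by rewrite [RHS]balg_joinE.
by rewrite leUx hE ?hF.
Qed.

Definition attains k j : Prop := exists E s, [/\ below E, codes_event s E
  & rel2 (density_ge k j) s Om].

(** The measures of the events [below] are compared with the multiples of
    [1 / k] only; the best multiple replaces the supremum of the measures, so
    that no real numbers are needed. *)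
Lemma attains_max k : exists j, attains k j /\ ~ attains k j.+1.
Proof.
pose P j := `[< attains k j >].
have P0 : exists j, P j.
  exists 0; apply/asboolP; have [s hs] := eventP (event0 S).
  exists (event0 S), s; split=> //; first exact: below0.
  by move: s Om {hs}; transfer => s c; rewrite /density_ge mul0n.
have Pk j : P j -> j <= k.
  move/asboolP=> [E [s [_ hs]]].
  have sub : forall x, rel2 memN x s -> rel2 memN x Om.
    by move=> x /hs[w _ <-]; apply: (svalP w).
  have := card_samples_gt0; rewrite leqNgt => c0 d; apply/negP => kj.
  move: s Om c0 sub d {hs}; transfer => s c c0 sub; rewrite /density_ge.
  have : cardN s <= cardN c by apply/fsubset_leq_card/fsubsetP.
  by nia.
exists (ex_maxn P0 Pk); case: ex_maxnP => j /asboolP hj jmax; split=> // hj'.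
by have := jmax j.+1; rewrite ltnn => h; move: (h (asboolT hj')).
Qed.

(** For each [k], choose an event [E k] below all upper bounds whose measure
    attains the best multiple [j k / k]. The type expressing that a code [x]
    contains every [E k] and has measure less than [(j k + 1) / k] for every [k]
    uses countably many parameters, and unions of finitely many [E k] satisfy
    its finite parts; saturation provides [x]. Its class is above [A]: an
    element of [A] exceeding [x] by [1 / k] could be joined to [E k],
    contradicting maximality. It is least: an upper bound contains [E k] up to
    an infinitesimal, hence [x] up to [1 / k]. *)
Lemma balg_sup : supremums A !=set0.
Proof.
have HM := @model_true S; have Om0 := card_samples_gt0.
pose good k (p : event S * S * nat) :=
  [/\ below p.1.1, codes_event p.1.2 p.1.1, rel2 (density_ge k p.2) p.1.2 Om
   & ~ attains k p.2.+1].
have /choice[p hp] : forall k, exists p, good k p.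
  by move=> k; have [j [[E [s [h1 h2 h3]]] nj]] := attains_max k; exists (E, s, j).
pose E k := (p k).1.1; pose s k := (p k).1.2; pose j k := (p k).2.
have bE k : below (E k) by have [] := hp k.
have sE k : codes_event (s k) (E k) by have [] := hp k.
have dE k : rel2 (density_ge k (j k)) (s k) Om by have [] := hp k.
(* an event below all upper bounds has measure less than (j k + 1) / k *)
have maxE k F t : below F -> codes_event t F -> ~ rel2 (density_ge k (j k).+1) t Om.
  by move=> bF tF dt; have [_ _ _] := hp k; apply; exists F, t.
pose R k (x s c : nat) : Prop := {subset set_of_code s <= set_of_code x} /\
  {subset set_of_code x <= set_of_code c} /\ ~ density_ge k (j k).+1 x c.
pose q k : pform S := existT _ 2 (Frel (fun t : 3.-tuple nat =>
  R k [tnth t 0] [tnth t 1] [tnth t 2]) (@Tvar 3), [tuple s k; Om]).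
have qE k x : psat x (q k) <-> rel3 (R k) x (s k) Om.
  rewrite /psat /= tuple_tnth /rel3.
  by have -> : [tuple of x :: [tuple s k; Om]] = [tuple x; s k; Om] by apply: val_inj.
have RE k x y : rel3 (R k) x y Om <->
    (forall z, rel2 memN z y -> rel2 memN z x) /\
    (forall z, rel2 memN z x -> rel2 memN z Om) /\ ~ rel2 (density_ge k (j k).+1) x Om.
  by move: x y Om {maxE sE dE Om0 qE q}; transfer.
have [x hx] : exists x, forall r, range q r -> psat x r.
  pose par k := if k is k'.+1 then s k' else Om.
  apply: (model_saturated (A := range par)).
  - exact: sub_countable (card_image_le _ _) (countableP _).
  - move=> _ [k _ <-] i /=; rewrite (tnth_nth Om).
    by case: i => [[|[|]]] //= _; [exists k.+1|exists 0].
  move=> F finF Fq.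
  have [K hK] := finite_image_bounded finF Fq.
  pose X := iteri K (fun k X => eventU X (E k)) (event0 S).
  have [x hx] := eventP X.
  exists x => r /hK[k kK ->]; apply/qE/RE; split.
    apply: subset_codes (sE k) hx _.
    move: kK; rewrite /X; clear; elim: K => [//|K IH]; rewrite ltnS leq_eqVlt /=.
    by case/predU1P=> [->|/IH h]; [right|left; apply: h].
  split; first by move=> z /hx[w _ <-]; apply: (svalP w).
  apply: (maxE k X) => //; rewrite /X {hK hx X kK}.
  elim: K => [|K IH]; first exact: below0.
  exact: belowU.
have {}hx k : rel3 (R k) x (s k) Om by apply/qE/hx; exists k.
pose X : set (Omega S) := [set w | rel2 memN (sval w) x].
have xX : codes_event x X.
  move=> y; split=> [yx|[w Xw <-] //].
  have [_ [/(_ y yx) yO _]] := (RE 0 _ _).1 (hx 0).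
  by exists (exist _ y yO).
have cX : coded X by exists x.
exists (\pi_(balg S) (Event cX)); split.
  elim/balg_ind=> B AB; apply/le_piP; have [t tB] := eventP B.
  exists (app2 diffN t x); first exact: codes_eventD.
  move=> k k0; apply: contrapT => nr.
  have bB : below (eventU B (E k)) by apply: belowU (bE k) => u; apply.
  apply: (maxE k _ _ bB (codes_eventU tB (sE k))).
  have [sx _] := (RE k _ _).1 (hx k).
  move: Om0 (dE k) sx nr; clear -k0.
  move: (j k) => l; move: (s k) Om t x; transfer.
  by move=> e c t x c0 ds sx nr; apply: density_union nr.
move=> u; elim/balg_ind: u => V hV; apply/le_piP; have [v vV] := eventP V.
exists (app2 diffN x v); first exact: codes_eventD.
(* each of the two parts of X \ V gets half of 1 / k *)
move=> k k0; pose K := k.*2.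
have /le_piP[y yE hy] := bE K _ hV.
apply: (mem_sub_ratio HM (t := app2 unionN (app2 diffN x (s K)) y)).
  move=> z; rewrite (mem_union HM) !(mem_diff HM) => -[zx zv].
  have [zs|] := EM (rel2 memN z (s K)); [right|by left].
  apply/yE; move/(sE K): zs => [w Ew wz]; exists w => //; split=> // Vw.
  by apply: zv; apply/vV; exists w.
apply: (ratio_union HM); rewrite (app1_std HM); last first.
  by apply: hy; rewrite double_gt0.
have [sx [_ nd]] := (RE K _ _).1 (hx K).
have K0 : 0 < K by rewrite double_gt0.
move: Om0 (dE K) sx nd; rewrite -/K; clear -K0.
move: K (j K) K0 => K l K0; move: (s K) Om x; transfer.
by move=> e c x c0 ds sx nd; apply: ratio_diff nd.
Qed.

End Completeness.

(** * Witnesses built from a uniform family *)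

Section Search.
Variables (n d : nat) (F : nat -> ltree).
Hypothesis smallF : forall i, small n d (F i).

(** Bisection of the interval from [lo] to [lo + 2 ^ j], on which the values of
    the trees [F i] change from nonzero to 0. *)
Fixpoint search (j lo : nat) : ltree :=
  if j is j'.+1 then
    bind (F (lo + 2 ^ j'))
      (fun v => if v == 0 then search j' lo else search j' (lo + 2 ^ j'))
  else GenTree.Leaf lo.

Lemma search_wf j lo : wf_tree n (search j lo).
Proof.
elim: j lo => [//|j IH] lo /=; apply: wf_bind; first by have [] := smallF (lo + 2 ^ j).
by move=> a _; case: eqP.
Qed.

Lemma search_depth j lo : depth (search j lo) <= j * d.
Proof.
elim: j lo => [//|j IH] lo /=; rewrite mulSn.
apply: (@leq_trans (depth (F (lo + 2 ^ j)) + j * d)).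
  by apply: depth_bind => a _; case: eqP.
by rewrite leq_add2r; have [] := smallF (lo + 2 ^ j).
Qed.

Lemma search_leaves j lo a : a \in leaves (search j lo) -> a < lo + 2 ^ j.
Proof.
elim: j lo => [|j IH] lo /=; first by rewrite inE addn1 ltnS => /eqP ->.
case/leaves_bind=> b _; rewrite expnS mul2n -addnn.
case: eqP => _ /IH; first by move/leq_trans; apply; rewrite addnA leq_addr.
by rewrite addnA.
Qed.

Lemma run_search w j lo : memN w (structures n) ->
  run w (F lo) <> 0 -> run w (F (lo + 2 ^ j)) = 0 ->
  run w (F (run w (search j lo))) <> 0 /\ run w (F (run w (search j lo)).+1) = 0.
Proof.
move=> hw; elim: j lo => [|j IH] lo /=; first by rewrite addn1.
rewrite expnS mul2n -addnn addnA => h0 h1.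
rewrite (run_bind hw); last by have [] := smallF (lo + 2 ^ j).
by case: eqP => [e|ne]; apply: IH.
Qed.

End Search.

(** The search starts from the interval up to the power [2 ^ e] above [m]; the
    trees beyond [m] are replaced by the constant 0, so that the value at the
    right end is 0 and the value is nonzero only at places below [m]. *)
Lemma search_tree n d e m s :
  (forall i, i <= m -> smallN n d (nthN s i)) -> m <= 2 ^ e ->
  exists T, smallN n (grow e d) T /\ forall w, memN w (structures n) ->
    runN (nthN s 0) w <> 0 -> runN (nthN s m) w = 0 ->
    [/\ runN T w < m, runN (nthN s (runN T w)) w <> 0
      & runN (nthN s (runN T w + 1)) w = 0].
Proof.
move=> hs me.
pose F i := if i <= m then tree_of_code (nthN s i) else GenTree.Leaf 0.
have smallF i : small n d (F i).
  by rewrite /F; case: ifP => [/hs//|_]; apply: small_Leaf.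
have Fin i : i <= m -> F i = tree_of_code (nthN s i) by rewrite /F => ->.
exists (choice.pickle (search F e 0)); rewrite /smallN /runN tree_codeK; split.
  split; first exact: search_wf smallF _ _.
    by apply: leq_trans (search_depth smallF e 0) _; rewrite /grow; nia.
  move=> a /search_leaves; rewrite add0n => /ltnW ha; apply: leq_trans ha _.
  by rewrite leq_exp2l// /grow; nia.
move=> w hw h0 hm.
have F0 : run w (F 0) <> 0 by rewrite Fin.
have Fe : run w (F (0 + 2 ^ e)) = 0.
  rewrite add0n; have [e'|] := leqP (2 ^ e) m.
    by rewrite (_ : 2 ^ e = m) ?Fin//; apply/eqP; rewrite eqn_leq e'.
  by rewrite ltnNge /F => /negPf ->.
have := run_search smallF hw F0 Fe.
set x := run w (search _ _ _) => -[hx hx'].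
have xm : x < m.
  rewrite ltnNge leq_eqVlt; apply/negP => /predU1P[mx|mx].
    by apply: hx; rewrite -mx Fin.
  by apply: hx; rewrite /F leqNgt mx.
by split=> //; rewrite ?addn1 -Fin// ltnW.
Qed.



Section Validity.
Variable S : setting.
Local Notation Om := (Omega S).
Local Notation n := (idx S).

(** Relations are decided by the symbol of their characteristic function. *)
Lemma uniform_rel k (R : k.-tuple nat -> Prop) (h : 'I_k -> Om -> S -> S) :
  (forall i, uniform (h i)) -> exists2 c, uniform c &
    forall w x, c w x <> std S 0 <-> relI R [tuple h i w x | i < k].
Proof.
move=> hh; pose f (u : k.-tuple nat) : nat := `[< R u >].
exists (fun w x => funI f [tuple h i w x | i < k]).
  apply: uniform_fun hh => v _; apply: inMn_le (inMn_std S 1).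
  by rewrite -(funI_comp0 1 v); apply: funI_le => u; rewrite /f; case: asbool.
move=> w x; rewrite -(funI_comp0 0 [tuple h i w x | i < k]) -funI_eq -relI_not.
by apply: relI_iff => u; rewrite /f; case: asboolP; split.
Qed.

Lemma uniform_rel2 (R : nat -> nat -> Prop) (h h' : Om -> S -> S) :
  uniform h -> uniform h' -> exists2 c, uniform c &
    forall w x, c w x <> std S 0 <-> rel2 R (h w x) (h' w x).
Proof.
move=> hh hh'.
have [|c hc E] := @uniform_rel 2 (fun t => R [tnth t 0] [tnth t 1])
  (tnth [tuple h; h']).
  by case=> [[|[|]]].
exists c => // w x; rewrite E /rel2.
by have -> : [tuple tnth [tuple h; h'] i w x | i < 2] = [tuple h w x; h' w x]
  by apply: eq_from_tnth => i; rewrite tnth_mktuple; case: i => [[|[|]]].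
Qed.

Definition nonzero (h : Om -> S -> S) (A : Om -> S) : set Om :=
  [set w | h w (A w) <> std S 0].

(** Membership is decided by a single tree, and the samples on which a coded
    tree has a nonzero value form a coded set. *)
Lemma coded_nonzero h (A : Fnb S) : uniform h -> coded (nonzero h A).
Proof.
move=> hh.
have [f hf] := uniform_Fnb (uniform_bind (uniform_cst A) hh) (inMn_std S 0).
have [T _ hT] := svalP f.
have [s hs] : exists s, forall x,
   rel2 memN x s <-> rel2 memN x (Mn_code S) /\ runM T x <> std S 0.
  rewrite /runM; move: T (Mn_code S) {hT}; transfer => T c.
  exists (choice.pickle [fset x in set_of_code c | runN T x != 0]%fset) => x.
  rewrite /memN set_of_codeK !inE /=.
  by split=> [/andP[-> /eqP]|[-> /eqP]].
exists s => x; rewrite hs; split=> [[xO xT]|[w hw <-]].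
  by exists (exist _ x xO) => //; rewrite /nonzero /= -hf /rvar hT.
by split; [apply: (svalP w)|rewrite -hT; move: hw; rewrite /nonzero /= -hf].
Qed.

(** At each sample the trees of the family, coded by one element of the model,
    give a coded partial function, and the graphs of the trees below [m] form
    the coded sequence required of a member of G_nb. *)
Lemma cut_function h m : uniform h -> inMn m -> exists X : Gnb S 0, forall w i,
  rapply (sval X) w [tuple i] =
  if pselect (rel2 ltN i m) then h w i else std S 0.
Proof.
move=> hh hm; have [s [d [hd hs E]]] := hh m hm.
pose F (w : Om) (v : 1.-tuple S) : option S :=
  if pselect (rel2 ltN (tnth v ord0) m) then Some (h w (tnth v ord0)) else None.
have Fcoded w : exists c, codes_pfun c (F w).
  have [c hc] : exists c, forall x, rel2 memN x c <-> exists i, rel2 ltN i m /\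
     x = app2 cpair (app1 (fun i => ctuple [tuple i]) i)
       (app2 runN (app2 nthN s i) (sval w)).
    move: (sval w) s m {hs E hm F}; transfer => v s m.
    exists (choice.pickle [fset cpair (ctuple [tuple i]) (runN (nthN s i) v)
      | i in iota 0 m]%fset) => x; rewrite /memN set_of_codeK.
    split=> [/imfsetP[i /= im ->]|[i [im ->]]].
      by exists i; split=> //; move: im; rewrite mem_iota.
    by apply/imfsetP; exists i => //=; rewrite mem_iota.
  exists c => x; rewrite hc; split=> [[i [im ->]]|[v [y [Fv ->]]]].
    exists [tuple i], (h w i); split; first by rewrite /F; case: pselect.
    by rewrite -app1_tuple E.
  move: Fv; rewrite /F; case: pselect => // im [<-]; exists (tnth v ord0).
  split=> //; rewrite E// app1_tuple; congr (app2 _ (funI _ _) _).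
  by apply: eq_from_tnth => i; rewrite (ord1 i).
have FMn w v y : F w v = Some y -> (forall i, inMn (tnth v i)) /\ inMn y.
  rewrite /F; case: pselect => // im [<-].
  have hv : inMn (tnth v ord0) by apply: inMn_le (ltM_le im) hm.
  by split=> [i|]; [rewrite (ord1 i)|apply: uniform_Mn].
pose X := Rfun Fcoded FMn.
have XE w i : rapply X w [tuple i] =
    if pselect (rel2 ltN i m) then h w i else std S 0.
  by rewrite /rapply /= /F; case: pselect.
suff hX : inGnb X by exists (exist _ X hX).
have [g [gm hg]] : exists g, app1 lenN g = m /\ forall i, rel2 ltN i m ->
    forall x, rel2 memN x (app2 nthN g i) <-> exists w,
      rel2 memN w (Mn_code S) /\ x = app2 cpair w (app2 runN (app2 nthN s i) w).
  move: (Mn_code S) s m {hs E hm F Fcoded FMn X XE}; transfer => c s m.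
  exists (choice.pickle (mkseq (fun i => choice.pickle
    [fset cpair w (runN (nthN s i) w) | w in set_of_code c]%fset) m)).
  rewrite /lenN {1 2}/nthN /seq_of_code choice.pickleK /= size_mkseq; split=> //.
  move=> i im x; rewrite nth_mkseq// /memN set_of_codeK.
  by split=> [/imfsetP[w /= wc ->]|[w [wc ->]]]; [exists w|apply/imfsetP; exists w].
have /choice[gamma hgamma] : forall i, exists f : Fnb S, rel2 ltN i m ->
    forall w, f w = h w i.
  move=> i; have [im|nim] := pselect (rel2 ltN i m).
    have [f hf] := uniform_Fnb hh (inMn_le (ltM_le im) hm); by exists f.
  by exists (cst (inMn_std S 0)).
exists g, gamma; rewrite gm; split=> //.
  move=> i; rewrite gm => im x; rewrite hg//; split=> [[w [wO ->]]|[w ->]].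
    by exists (exist _ w wO); rewrite hgamma// E.
  by exists (sval w); split; [apply: (svalP w)|rewrite hgamma// E].
by move=> f w; rewrite XE; case: pselect => // im; rewrite hgamma.
Qed.

(** The depth of the search tree is at most the product of the shallow depth of
    the family up to [m] and the shallow logarithm of [m]. *)
Lemma sign_change h m : uniform h -> inMn m -> exists f : Fnb S, forall w,
  h w (std S 0) <> std S 0 -> h w m = std S 0 ->
  [/\ rel2 ltN (f w) m, h w (f w) <> std S 0
    & h w (app2 addn (f w) (std S 1)) = std S 0].
Proof.
move=> hh hm; have [s [d [hd hs E]]] := hh _ (inMn_succ hm).
have {}hs i : rel2 leN i m -> rel3 smallN n d (app2 nthN s i).
  by move/ltM_succ; apply: hs.
have {}E w i : rel2 leN i m -> h w i = runM (app2 nthN s i) (sval w).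
  by move/ltM_succ; apply: E.
have /inMnP[e he me] := hm.
have [T [hT T_search]] : exists T, rel3 smallN n (app2 grow e d) T /\
    forall w, rel2 memN w (app1 structures n) ->
     app2 runN (app2 nthN s (std S 0)) w <> std S 0 ->
     app2 runN (app2 nthN s m) w = std S 0 ->
     rel2 ltN (app2 runN T w) m /\
     app2 runN (app2 nthN s (app2 runN T w)) w <> std S 0 /\
     app2 runN (app2 nthN s (app2 addn (app2 runN T w) (std S 1))) w = std S 0.
  move: hs me {hh hm hd he E}; move: n d e m s; transfer => k d e m s hs me.
  have [T [hT run_T]] := search_tree hs me; exists T; split=> // w hw h0 h1.
  by have [] := run_T w hw h0 h1.
have Tnb : exists2 T', inTnb T' & forall w : Om, runM T (sval w) = runM T' (sval w).
  by exists T => //; apply/inTnbP; exists (app2 grow e d) => //;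
    apply: shallow_grow.
exists (exist _ (fun w => runM T (sval w)) Tnb) => w.
have mm : rel2 leN m m by move: m {hm hs E me T_search}; transfer => m; apply: leqnn.
have m0 : rel2 leN (std S 0) m by move: m {mm hm hs E me T_search}; transfer => m.
rewrite /rvar /= (E w (std S 0) m0) (E w m mm) => h0 h1.
have [lt [h2 h3]] := T_search _ (sampleP w) h0 h1.
have le1 : forall x y, rel2 ltN x y -> rel2 leN (app2 addn x (std S 1)) y.
  by transfer => x y; rewrite /leN addn1.
by split=> //; rewrite E//; [apply: ltM_le|apply: le1].
Qed.

End Validity.

(** * Truth values of open formulas *)

Section EventClass.
Variable S : setting.
Implicit Types A B : set (Omega S).

Lemma event_classE A (hA : coded A) :
  event_class A = (\pi_(balg S) (Event hA))%qT.
Proof.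
rewrite /event_class; case: pselect => // hA'.
by rewrite (Prop_irrelevance hA' hA).
Qed.

Lemma event_classT : event_class setT = \top%O :> balg S.
Proof.
rewrite (event_classE (codedT S)) [RHS]/(\top%O).
by congr (\pi_(balg S) _)%qT; apply: event_inj.
Qed.

Lemma event_class0 : event_class set0 = \bot%O :> balg S.
Proof.
rewrite (event_classE (coded0 S)) [RHS]/(\bot%O).
by congr (\pi_(balg S) _)%qT; apply: event_inj.
Qed.

Lemma event_classC A : coded A -> event_class (~` A) = (~` event_class A)%O.
Proof.
move=> hA; rewrite (event_classE hA) (event_classE (codedC hA)).
by rewrite [RHS]balg_complE; congr (\pi_(balg S) _)%qT; apply: event_inj.
Qed.

Lemma event_classI A B : coded A -> coded B ->
  event_class (A `&` B) = (event_class A `&` event_class B)%O.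
Proof.
move=> hA hB; rewrite (event_classE hA) (event_classE hB) (event_classE (codedI hA hB)).
by rewrite [RHS]balg_meetE; congr (\pi_(balg S) _)%qT; apply: event_inj.
Qed.

Lemma event_classU A B : coded A -> coded B ->
  event_class (A `|` B) = (event_class A `|` event_class B)%O.
Proof.
move=> hA hB; rewrite (event_classE hA) (event_classE hB) (event_classE (codedU hA hB)).
by rewrite [RHS]balg_joinE; congr (\pi_(balg S) _)%qT; apply: event_inj.
Qed.

End EventClass.

Section Agree.
Context {disp : Order.disp_t} {L : ctbDistrLatticeType disp}.
Implicit Types a b e : L.
Local Open Scope order_scope.

(** Equality of [a] and [b] below [e], that is, in the quotient by the
    complement of [e]; a congruence for the Boolean operations. *)
Definition agree e a b : Prop := e `&` a = e `&` b.

Lemma agreeC e a b : agree e a b -> agree e (~` a) (~` b).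
Proof.
have E c : e `&` ~` c = e `&` ~` (e `&` c).
  by rewrite complI meetUr meetxC join0x.
by move=> ab; rewrite /agree E ab -E.
Qed.

Lemma agreeI e a b a' b' :
  agree e a b -> agree e a' b' -> agree e (a `&` a') (b `&` b').
Proof. by rewrite /agree => ab ab'; rewrite meetA ab meetAC ab' meetAC meetA. Qed.

Lemma agreeU e a b a' b' :
  agree e a b -> agree e a' b' -> agree e (a `|` a') (b `|` b').
Proof. by rewrite /agree => ab ab'; rewrite !meetUr ab ab'. Qed.

Lemma agree_le e e' a b : e' <= e -> agree e a b -> agree e' a b.
Proof. by rewrite /agree => /meet_idPl <- ab; rewrite -!meetA ab. Qed.

Lemma agree_top e a : agree e a \top -> e <= a.
Proof. by rewrite /agree meetx1 => <-; apply: leIr. Qed.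

End Agree.

Section Open.
Variable S : setting.
Local Open Scope order_scope.
Local Notation Om := (Omega S).

(** Truth value of an open formula when all its number variables denote [A], an
    arbitrary function on the sample space. Substitution of a term for the
    variable becomes a change of [A] ([truth_subst]). The value at
    quantified formulas is a dummy. *)
Fixpoint ptruth s k (p : lform S s k) : senv S s -> (Om -> S) -> balg S :=
  match p with
  | Rel _ _ a R ts => fun U A =>
      event_class [set w | relI R [tuple peval U (ts i) w (A w) | i < a]]
  | Eqn _ _ t t' => fun U A =>
      event_class [set w | peval U t w (A w) = peval U t' w (A w)]
  | Eqs _ _ _ X Y => fun U _ => event_class [set w | evals U X w = evals U Y w]
  | Not _ _ q => fun U A => ~` ptruth q U A
  | And _ _ q r => fun U A => ptruth q U A `&` ptruth r U A
  | Or _ _ q r => fun U A => ptruth q U A `|` ptruth r U A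
  | All _ _ _ | Ex _ _ _ | All2 _ _ _ _ | Ex2 _ _ _ _ => fun _ _ => \bot
  end.

Lemma truth_subst s k (p : lform S s k) (U : senv S s) s' (rho : sren s s')
    (U' : senv S s') k' (u : k'.-tuple (Fnb S)) (t0 : nterm S s' k') :
  (forall a (v : svar s a), U' _ (rho _ v) = U _ v) -> is_open p ->
  truth (subst p rho (fun=> t0)) U' u = ptruth p U (evaln U' u t0).
Proof.
elim: p U s' rho U' k' u t0 => //.
- move=> {}s {}k a R ts U s' rho U' k' u t0 hU _ /=; congr event_class.
  apply/funext => w; rewrite /mkset; congr (relI R).
  by apply: eq_mktuple => i; apply: evaln_subst.
- move=> {}s {}k t t' U s' rho U' k' u t0 hU _ /=; congr event_class.
  by apply/seteqP; split=> w /=; rewrite !(evaln_subst hU).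
- move=> {}s {}k a X Y U s' rho U' k' u t0 hU _ /=; congr event_class.
  by apply/seteqP; split=> w /=; rewrite !(evals_subst hU).
- by move=> {}s {}k q IH U s' rho U' k' u t0 hU ho /=; rewrite (IH U).
- move=> {}s {}k q IH r IH' U s' rho U' k' u t0 hU /andP[hq hr] /=.
  by rewrite (IH U) ?(IH' U).
- move=> {}s {}k q IH r IH' U s' rho U' k' u t0 hU /andP[hq hr] /=.
  by rewrite (IH U) ?(IH' U).
Qed.

End Open.


Section Decision.
Variable S : setting.
Local Notation Om := (Omega S).
Local Open Scope order_scope.

(** The element [e] is arbitrary: no tree need decide the events of its
    class. *)
Definition decides s k (p : lform S s k) (U : senv S s) (e : balg S)
    (h : Om -> S -> S) : Prop :=
  uniform h /\ forall A : Fnb S, agree e (ptruth p U A) (event_class (nonzero h A)).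

Lemma eq_class A B :
  (forall w : Om, A w <-> B w) -> event_class A = event_class B.
Proof. by move=> AB; congr event_class; apply/seteqP; split=> w /AB. Qed.

(** The truth-value parameters for which some uniform family decides [p] cover
    the algebra; stating this as an induction principle for [e0 <= c] replaces
    finite lists of pieces by nested applications. Atomic formulas of number
    sort are decided everywhere. For an equality of set sort with truth value
    [b], the constant families 1 and 0 decide it below [b] and below the
    complement of [b]. *)
Lemma decides_cover s k (p : lform S s k) (U : senv S s) (e0 c : balg S) :
  is_open p -> (forall e h, decides p U e h -> e0 `&` e <= c) -> e0 <= c.
Proof.
elim: p U e0 c => //.
- move=> {}s {}k a R ts U e0 c _ hc.
  have [h hh E] := uniform_rel R (fun i => uniform_peval U (ts i)).
  rewrite -[e0]meetx1; apply: (hc \top h); split=> // A.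
  by congr (_ `&` _); apply: eq_class => w; apply: iff_sym; apply: E.
- move=> {}s {}k t t' U e0 c _ hc.
  have [h hh E] := uniform_rel2 eq (uniform_peval U t) (uniform_peval U t').
  have eqE : forall x y : S, rel2 eq x y <-> x = y by transfer.
  rewrite -[e0]meetx1; apply: (hc \top h); split=> // A.
  by congr (_ `&` _); apply: eq_class => w; rewrite /nonzero /= E eqE.
- move=> {}s {}k a X Y U e0 c _ hc.
  set b := ptruth (Eqs k X Y) U (fun=> std S 0).
  have cst0 : uniform (fun _ _ : _ => std S 0) := uniform_cst (cst (inMn_std S 0)).
  have cst1 : uniform (fun _ _ : _ => std S 1) := uniform_cst (cst (inMn_std S 1)).
  have n10 : std S 1 <> std S 0 by transfer.
  rewrite -[e0]meetx1 -(joinxC b) meetUr leUx; apply/andP; split.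
    apply: (hc _ (fun _ _ => std S 1)); split=> // A; rewrite -[ptruth _ _ _]/b.
    rewrite /agree meetxx (_ : nonzero _ _ = setT) ?event_classT ?meetx1//.
    by apply/seteqP; split.
  apply: (hc _ (fun _ _ => std S 0)); split=> // A; rewrite -[ptruth _ _ _]/b.
  rewrite /agree meetC meetxC (_ : nonzero _ _ = set0) ?event_class0 ?meetx0//.
  by apply/seteqP; split=> // w.
- move=> {}s {}k q IH U e0 c hq hc; apply: (IH U) => // e h [hh hA].
  have [h' hh' E] := uniform_rel2 (fun x _ => x = 0%N) hh hh.
  have eqE : forall x y : S, rel2 (fun x _ => x = 0%N) x y <-> x = std S 0 by transfer.
  apply: (hc e h'); split=> // A.
  rewrite (_ : event_class _ = ~` event_class (nonzero h A)).
    exact: agreeC.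
  rewrite -event_classC; last exact: coded_nonzero.
  by apply: eq_class => w; rewrite /nonzero /= E eqE notK.
- move=> {}s {}k q IH r IH' U e0 c /andP[hq hr] hc.
  apply: (IH U) => // e h [hh hA]; apply: (IH' U) => // e' h' [hh' hA'].
  rewrite -meetA; have [g hg E] := uniform_rel2 (fun x y => x <> 0%N /\ y <> 0%N) hh hh'.
  have eqE : forall x y : S, rel2 (fun x y => x <> 0%N /\ y <> 0%N) x y <->
    x <> std S 0 /\ y <> std S 0 by transfer.
  apply: (hc _ g); split=> // A.
  rewrite (_ : event_class _ =
      event_class (nonzero h A) `&` event_class (nonzero h' A)).
    apply: agreeI; [apply: agree_le (hA A)|apply: agree_le (hA' A)];
      by rewrite ?leIl ?leIr.
  rewrite -event_classI; try exact: coded_nonzero.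
  by apply: eq_class => w; rewrite /nonzero /= E eqE.
- move=> {}s {}k q IH r IH' U e0 c /andP[hq hr] hc.
  apply: (IH U) => // e h [hh hA]; apply: (IH' U) => // e' h' [hh' hA'].
  rewrite -meetA; have [g hg E] := uniform_rel2 (fun x y => x <> 0%N \/ y <> 0%N) hh hh'.
  have eqE : forall x y : S, rel2 (fun x y => x <> 0%N \/ y <> 0%N) x y <->
    x <> std S 0 \/ y <> std S 0 by transfer.
  apply: (hc _ g); split=> // A.
  rewrite (_ : event_class _ =
      event_class (nonzero h A) `|` event_class (nonzero h' A)).
    apply: agreeU; [apply: agree_le (hA A)|apply: agree_le (hA' A)];
      by rewrite ?leIl ?leIr.
  rewrite -event_classU; try exact: coded_nonzero.
  by apply: eq_class => w; rewrite /nonzero /= E eqE.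
Qed.

(** * The two schemes *)

(** An infimum of a set without greatest lower bound is the default [\top], so
    existence is not an issue for lower estimates; for [supremum_ge] it is, and
    the completeness of the algebra is used there. *)
Lemma le_infimum (B : set (balg S)) (e : balg S) :
  (forall b, B b -> e <= b) -> e <= infimum \top B.
Proof.
move=> eB; rewrite /infimum; case: ifP => _; first exact: lex1.
by case: xgetP => [x _ [_ xB]|_]; [apply: xB|apply: lex1].
Qed.

Lemma supremum_ge (B : set (balg S)) (b : balg S) : B b -> b <= supremum \bot B.
Proof.
move=> Bb; rewrite /supremum; case: ifPn => [/eqP B0|_].
  by move: Bb; rewrite B0.
by have [ub _] := xgetPex \bot (balg_sup B); apply: ub.
Qed.

Lemma event_class_top (A : set Om) :
  (forall w, A w) -> event_class A = \top :> balg S.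
Proof. by move=> hA; rewrite -event_classT; apply: eq_class. Qed.

Section Schemes.
Variables (phi : lform S [::] 1) (m : S).
Hypotheses (phi_open : is_open phi) (m_Mn : inMn m).

Lemma coded_lt (f g : Fnb S) : coded [set w | rel2 ltN (f w) (g w)].
Proof.
have [h hh E] := uniform_rel2 ltN (uniform_cst f) (uniform_cst g).
have [s hs] := coded_nonzero (cst (inMn_std S 0)) hh.
exists s => x; rewrite hs.
by split=> -[w hw <-]; exists w => //; move: hw; rewrite /nonzero /= E.
Qed.

Lemma truth_at s (U : senv S s) k (u : k.-tuple (Fnb S)) (t : nterm S s k) :
  truth (at_term phi t) U u = ptruth phi (senv0 S) (evaln U u t).
Proof.
have no_svar a : svar [::] a -> False by move=> v; inversion v.
by apply: truth_subst => // a v; case: (no_svar a v).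
Qed.

Lemma evaln_num s (U : senv S s) k (u : k.-tuple (Fnb S)) c :
  evaln U u (num S s k c) = fun=> std S c.
Proof. by apply/funext => w; rewrite /=; congr funI; apply: eq_from_tnth => -[]. Qed.

Lemma truth_Lt s (U : senv S s) k (u : k.-tuple (Fnb S)) (t t' : nterm S s k) :
  truth (Lt t t') U u =
  event_class [set w | rel2 ltN (evaln U u t w) (evaln U u t' w)].
Proof.
congr event_class; apply/funext => w; rewrite /mkset /rel2; congr relI.
by apply: eq_from_tnth => i; rewrite tnth_mktuple; case: i => [[|[|]]].
Qed.

Lemma truth_Mem s (U : senv S s) k (u : k.-tuple (Fnb S)) (X : sterm S s 0)
    (t : nterm S s k) :
  truth (Mem X t) U u =
  ~` event_class [set w | rapply (evals U X) w [tuple evaln U u t w] = std S 0].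
Proof.
change (~` event_class [set w | rapply (evals U X) w
  [tuple evaln U u t w | _ < 1] = evaln U u (num S s k 0) w] =
  ~` event_class [set w | rapply (evals U X) w [tuple evaln U u t w] = std S 0]).
congr (~` event_class _); apply/funext => w; rewrite /mkset evaln_num.
by congr (rapply _ _ _ = _); apply: eq_from_tnth => i; rewrite tnth_mktuple (ord1 i).
Qed.

(** Below [e], replacing the truth value of the formula by the event that [h]
    is nonzero changes nothing, and with this event the matrix of the scheme
    holds at every sample. *)
Lemma comprehension_valid : valid (open_comprehension phi (cst m_Mn)).
Proof.
apply/eqP; rewrite -le1x.
apply: (decides_cover (U := senv0 S) phi_open) => e h [hh hphi].
rewrite meet1x; have [X hX] := cut_function hh m_Mn.
apply: le_trans (supremum_ge _); last by exists X.
apply: le_infimum => _ [f _ <-]; apply: agree_top.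
set y := NVar S [:: 0%N] ord0; set U := scons X (senv0 S).
pose u := [tuple of f :: ([tuple] : 0.-tuple (Fnb S))].
pose L := truth (Lt y (NPar [:: 0%N] 1 (cst m_Mn))) U u.
pose M := truth (Mem (SVar S SZ) y) U u; pose P := truth (at_term phi y) U u.
change (agree e (~` L `|` ((~` M `|` P) `&` (~` P `|` M))) \top).
have yE : evaln U u y = f by [].
have hP : agree e P (event_class (nonzero h f)).
  by rewrite /P truth_at yE; apply: hphi.
pose lt := [set w : Om | rel2 ltN (f w) m].
have clt : coded lt := coded_lt f (cst m_Mn).
have cnz : coded (nonzero h f) by apply: coded_nonzero.
have LE : L = event_class lt by rewrite /L truth_Lt.
have ME : M = event_class (lt `&` nonzero h f)%classic.
  rewrite /M truth_Mem -[(lt `&` _)%classic]setCK event_classC; last by apply/codedC/codedI.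
  congr (~` _); apply: eq_class => w; rewrite /setC /mkset yE -[evals _ _]/(sval X) hX.
  rewrite /lt /nonzero /=.
  by case: pselect => lw /=; have := EM (h w (f w) = std S 0); tauto.
rewrite LE ME; set N := event_class (_ `&` _).
have top : ~` event_class lt `|` ((~` N `|` event_class (nonzero h f)) `&`
    (~` event_class (nonzero h f) `|` N)) = \top :> balg S.
  have cI := codedI clt cnz.
  rewrite /N -!event_classC// -!event_classU//; try exact: codedC.
  rewrite -event_classI; try by apply: codedU => //; apply: codedC.
  rewrite -event_classU; try exact: codedC; last first.
    by apply: codedI; apply: codedU => //; apply: codedC.
  apply: event_class_top => w /=.
  by have := EM (lt w); have := EM (nonzero h f w); tauto.
rewrite /agree -top; apply: agreeU => //; apply: agreeI; first exact: agreeU.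
by apply: agreeU => //; apply: agreeC.
Qed.

(** The member of F_nb found by binary search is an instance of the existential
    quantifier that makes the scheme hold at every sample. *)
Lemma induction_valid : valid (open_induction phi (cst m_Mn)).
Proof.
apply/eqP; rewrite -le1x.
apply: (decides_cover (U := senv0 S) phi_open) => e h [hh hphi].
rewrite meet1x; have [f hf] := sign_change hh m_Mn.
pose zero := cst (inMn_std S 0); pose M := cst m_Mn.
have [g gE] : exists g : Fnb S, forall w, g w = app2 addn (f w) (std S 1).
  have addE : forall y : S, app1 succn y = app2 addn y (std S 1).
    by transfer => y; rewrite addn1.
  have succ_Mn (y : S) : inMn y -> inMn (app1 succn y).
    by move=> hy; rewrite addE; apply: inMn_succ.
  have [g gE] := uniform_Fnb (uniform_bind (uniform_cst f) (uniform_map succ_Mn))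
    (inMn_std S 0).
  by exists g => w; rewrite -addE gE.
pose P (A : Fnb S) := ptruth phi (senv0 S) A.
have hP A : agree e (P A) (event_class (nonzero h A)) by apply: hphi.
pose x : nterm S [::] 1 := NVar S [::] ord0.
pose body := And (Lt x (NPar [::] 1 M)) (And (at_term phi x)
  (Not (at_term phi (add x (num S [::] 1 1))))).
have bodyE : truth body (senv0 S) [tuple of f :: [tuple]] =
    event_class [set w | rel2 ltN (f w) (M w)] `&` (P f `&` ~` P g).
  rewrite -[LHS]/(truth (Lt _ _) _ _ `&` (truth _ _ _ `&` ~` truth _ _ _)).
  rewrite truth_Lt !truth_at; congr (_ `&` (ptruth _ _ _ `&` ~` ptruth _ _ _)).
  apply/funext => w; rewrite gE /=; congr funI.
  apply: eq_from_tnth => i; rewrite tnth_mktuple.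
  case: i => [[|[|//]] lt_i]; first by [].
  exact: (congr1 (@^~ w) (evaln_num (senv0 S) [tuple of f :: [tuple]] 1)).
apply: (@le_trans _ _ (~` P zero `|` (P M `|`
    truth body (senv0 S) [tuple of f :: [tuple]]))).
  rewrite bodyE; apply: agree_top.
  pose N A := event_class (nonzero h A).
  pose lt := [set w : Om | rel2 ltN (f w) (M w)].
  have clt : coded lt := coded_lt f M.
  have cN (A : Fnb S) : coded (nonzero h A) by apply: coded_nonzero.
  have top : ~` N zero `|` (N M `|` (event_class lt `&` (N f `&` ~` N g))) = \top
      :> balg S.
    have cNC A := codedC (cN A).
    have c1 := codedI (cN f) (cNC g); have c2 := codedI clt c1.
    rewrite /N -!event_classC// -event_classI// -event_classI// -event_classU//.
    rewrite -event_classU//; last exact: codedU.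
    apply: event_class_top => w; rewrite /nonzero /= gE.
    have [h0|] := EM (h w (std S 0) = std S 0); first by left.
    have [hm|] := EM (h w m = std S 0); last by right; left.
    by move=> /hf /(_ hm)[lt_f h1 h2]; right; right; split=> //; split=> // -[].
  rewrite /agree -top; apply: agreeU; first exact/agreeC/hP.
  apply: agreeU; first exact: hP.
  by apply: agreeI => //; apply: agreeI; [apply: hP|apply/agreeC/hP].
rewrite -[X in _ <= X]/(~` truth _ _ _ `|` (truth _ _ _ `|` supremum \bot _)).
rewrite !truth_at evaln_num; apply: leU2 => //; apply: leU2 => //.
by apply: supremum_ge; exists f.
Qed.

End Schemes.
End Decision.

Theorem theorem6p12 (S : setting) (phi : lform S [::] 1) (phi_open : is_open phi)
    (m : S) (m_Mn : inMn m) :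
  valid (open_comprehension phi (cst m_Mn)) /\
  valid (open_induction phi (cst m_Mn)).
Proof. by split; [apply: comprehension_valid|apply: induction_valid]. Qed.
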